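(* Let $\mathsf n,t\ge1$, $N=2^{\mathsf n}$, and let \[ \mathcal C_{\mu,t}=\mathbb E_{P\sim\mathcal P_{\mathsf n}}\mathbb E_{\theta\sim(-\pi,\pi)}\big(e^{\mathrm i\theta P/2}\big)^{\otimes t}\otimes\big(e^{-\mathrm i\theta\bar P/2}\big)^{\otimes t},\qquad\mathcal H_t=\int_{\mathrm{SU}(N)}(U\otimes\bar U)^{\otimes t}dU, \] where $P$ is uniform on $\mathcal P_{\mathsf n}=\{\mathbf 1_2,\sigma^x,\sigma^y,\sigma^z\}^{\otimes\mathsf n}\setminus\{\mathbf 1_N\}$, $\theta$ uniform, and $dU$ the Haar probability measure. Then \[ \|\mathcal C_{\mu,t}-\mathcal H_t\|\le1-\frac1{4t}\frac{N^2}{N^2-1}-\frac1{N^2-1}. \] If moreover $t\le N/2$, then \[ \|\mathcal C_{\mu,t}-\mathcal H_t\|\le1-\frac1{2t}\frac{N(N-t+1)}{N^2-1}. \]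
   Context: $\|\cdot\|$ is the operator norm; $\bar P$ is the entrywise complex conjugate. *)

(* Defs.v *)
From HB Require Import structures.
From mathcomp Require Import all_boot all_order all_algebra.
From mathcomp Require Import all_classical all_reals all_analysis.
From mathcomp Require Import complex.
Set Implicit Arguments. Unset Strict Implicit. Unset Printing Implicit Defensive.
Import Order.TTheory GRing.Theory Num.Theory.
Import numFieldTopology.Exports numFieldNormedType.Exports.
Local Open Scope classical_set_scope.
Local Open Scope ring_scope.
Local Open Scope complex_scope.

Section Defs.
Variable R : realType.
Local Notation C := R[i].

HB.instance Definition _ := PseudoPointedMetric.copy R[i] (R[i])^o.
HB.instance Definition _ := NormedModule.copy R[i] (R[i])^o.

(* index splitting 'I_(m*n) -> 'I_m * 'I_n (fixed bijection, as for mxvec) *)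
Definition kron_idx m n (k : 'I_(m * n)) : 'I_m * 'I_n :=
  enum_val (cast_ord (esym (mxvec_cast m n)) k).

Definition kron m1 n1 m2 n2 (A : 'M[C]_(m1, n1)) (B : 'M[C]_(m2, n2))
  : 'M[C]_(m1 * m2, n1 * n2) :=
  \matrix_(i, j) (A (kron_idx i).1 (kron_idx j).1 * B (kron_idx i).2 (kron_idx j).2).

Fixpoint kronpow n (A : 'M[C]_n) (t : nat) : 'M[C]_(n ^ t) :=
  match t return 'M[C]_(n ^ t) with
  | 0 => castmx (esym (expn0 n), esym (expn0 n)) (1%:M : 'M[C]_1)
  | t'.+1 => castmx (esym (expnS n t'), esym (expnS n t'))
                    (kron A (kronpow A t'))
  end.

Definition cmx_conj m n (A : 'M[C]_(m, n)) : 'M[C]_(m, n) := map_mx conjc A.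
Definition cmx_adj m n (A : 'M[C]_(m, n)) : 'M[C]_(n, m) := (cmx_conj A)^T.

Definition expmx n (A : 'M[C]_n) : 'M[C]_n :=
  lim (series (fun k : nat => (k`!%:R : C)^-1 *: A ^+ k) @ \oo).

(* Pauli matrices: index 0 = identity, 1 = sigma^x, 2 = sigma^y, 3 = sigma^z *)
Definition pauli1 (a : 'I_4) : 'M[C]_2 :=
  \matrix_(i < 2, j < 2)
   (match val a with
    | 0 => if i == j then 1 else 0
    | 1 => if i == j then 0 else 1
    | 2 => if i == j then 0 else (if val i == 0 then - 'i else 'i)
    | _ => if i == j then (if val i == 0 then 1 else -1) else 0
    end).

Fixpoint pauli_string (n : nat) : ('I_n -> 'I_4) -> 'M[C]_(2 ^ n) :=
  match n return ('I_n -> 'I_4) -> 'M[C]_(2 ^ n) with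
  | 0 => fun _ => castmx (esym (expn0 2), esym (expn0 2)) (1%:M : 'M[C]_1)
  | n'.+1 => fun s => castmx (esym (expnS 2 n'), esym (expnS 2 n'))
        (kron (pauli1 (s ord0)) (pauli_string (fun i => s (lift ord0 i))))
  end.

Definition vnorm n (x : 'cV[C]_n) : R :=
  Num.sqrt (\sum_i ((complex.Re (x i 0)) ^+ 2 + (complex.Im (x i 0)) ^+ 2)).

Definition opnorm m n (A : 'M[C]_(m, n)) : R :=
  sup [set r : R | exists x : 'cV[C]_n, vnorm x <= 1 /\ r = vnorm (A *m x)].

Definition theta_avg m n (F : R -> 'M[C]_(m, n)) : 'M[C]_(m, n) :=
  \matrix_(i, j)
   (((2 * pi)^-1 * \int[lebesgue_measure]_(x in `]- pi, pi[) complex.Re (F x i j))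
    +i* ((2 * pi)^-1 * \int[lebesgue_measure]_(x in `]- pi, pi[) complex.Im (F x i j))).

Definition pauli_rot_moment (n t : nat) : 'M[C]_((2 ^ n) ^ t * (2 ^ n) ^ t) :=
  ((4 ^ n - 1)%:R : C)^-1 *:
  \sum_(s : {ffun 'I_n -> 'I_4} | s != [ffun => ord0])
    theta_avg (fun th : R =>
      kron (kronpow (expmx (('i * (th / 2)%:C) *: pauli_string s)) t)
           (kronpow (expmx ((- 'i * (th / 2)%:C) *: cmx_conj (pauli_string s))) t)).

Definition SU N : set 'M[C]_N :=
  [set U | cmx_adj U *m U = 1%:M /\ \det U = 1].

Definition mx_expect d (T : measurableType d) (P : probability T R)
  m n (X : T -> 'M[C]_(m, n)) : 'M[C]_(m, n) :=
  \matrix_(i, j) ((\int[P]_(w in setT) complex.Re (X w i j)) +i* (\int[P]_(w in setT) complex.Im (X w i j))).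

(* U is a Haar-distributed random element of SU(N): it takes values in SU(N),
   its real coordinates are measurable, and its law is invariant under left
   multiplication by every V in SU(N) (equality of laws expressed through all
   bounded continuous test functions). By uniqueness of the Haar probability
   measure, this characterises the Haar law. *)
Definition haar_rv d (T : measurableType d) (P : probability T R) N
  (U : T -> 'M[C]_N) : Prop :=
  (forall w, @SU N (U w)) /\
  (forall i j, measurable_fun setT (fun w => complex.Re (U w i j)) /\
               measurable_fun setT (fun w => complex.Im (U w i j))) /\
  (forall V, @SU N V -> forall f : 'M[C]_N -> R, continuous f ->
     (exists M : R, forall A, `|f A| <= M) ->
     \int[P]_(w in setT) f (V *m U w) = \int[P]_(w in setT) f (U w)).

End Defs.

Arguments kron {R m1 n1 m2 n2}.
Arguments kronpow {R n}.
Arguments cmx_conj {R m n}.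
Arguments cmx_adj {R m n}.
Arguments expmx {R n}.
Arguments opnorm {R m n}.
Arguments vnorm {R n}.
Arguments theta_avg {R m n}.
Arguments mx_expect {R d T} P {m n}.
Arguments haar_rv {R d T} P {N}.
Arguments SU {R}.

(* Main.v *)
(* Write tau(U) for U^{(x) t} (x) conj(U)^{(x) t} and lie(X) for its differential; tau acts on
   functions of 2t "slots", t of them covariant and t of them dual.

   For a Pauli string P, lie(P) has even integer eigenvalues, so averaging exp(i theta lie(P)/2)
   over theta yields the projector onto the kernel of lie(P). The Pauli completeness relation
   gives sum_P lie(P)^2 = N * Cas, where Cas = sum_{ij} lie(E_ij) lie(E_ji) commutes with every
   tau(U) and hence with both C_{mu,t} and H_t; it suffices to bound the difference on each
   eigenspace W of Cas.

   On ker Cas both operators are the identity. On any other W the Haar projector vanishes. Among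
   the weights h of W, maximize first K = sum_k |h_k| and then sum_k h_k^2: a vector w of such a
   weight satisfies E_ij w = 0 whenever i <> j and h_j <= h_i, so the eigenvalue of Cas on W is
   sum_k h_k^2 + (1/2) sum_{ij} |h_i - h_j|. Moreover |lie(P)| <= K <= 2t on W, hence the
   projector onto ker lie(P) is at most 1 - lie(P)^2 / K^2 there, and averaging over P bounds
   C_{mu,t} by 1 - N Cas / (K^2 (N^2 - 1)). The two estimates of the theorem come from two lower
   bounds of the eigenvalue: N K / 2 + K^2 / N for real weights, and K + N K - K^2 / 2 for
   integer ones. *)
Require Import Defs.
From HB Require Import structures.
From mathcomp Require Import all_boot all_order all_algebra.
From mathcomp Require Import all_classical all_reals all_analysis.
From mathcomp Require Import measurable_realfun complex.
From mathcomp Require Import zify ring lra.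
Set Implicit Arguments. Unset Strict Implicit. Unset Printing Implicit Defensive.
Import Order.TTheory GRing.Theory Num.Theory.
Import numFieldTopology.Exports numFieldNormedType.Exports.
Local Open Scope ring_scope.
Local Open Scope sesquilinear_scope.

(** * Tensor products of matrices and their differentials *)

Section Tensor.
Variables (C : numClosedFieldType) (N M : nat) (S : finType).
Variable g : 'I_M -> {ffun S -> 'I_N}.
Hypothesis g_bij : bijective g.

(** The bijection [g] reads a matrix index as one letter per slot, so no order on the slots is
    needed; the same definition serves Pauli strings (slots are qubits) and moments (slots are the
    2t factors). *)
Definition tens (B : S -> 'M[C]_N) : 'M[C]_M :=
  \matrix_(i, j) \prod_s B s (g i s) (g j s).

Lemma eq_tens B B' : B =1 B' -> tens B = tens B'.
Proof.
by move=> e; apply/matrixP => i j; rewrite !mxE; apply: eq_bigr => s _; rewrite e.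
Qed.

(** As [g] is bijective, summing over the middle index is summing over all choices of one letter per
    slot, and a product over slots of sums over letters expands into exactly that sum. *)
Lemma tens_mul B B' : tens B *m tens B' = tens (fun s => B s *m B' s).
Proof.
apply/matrixP => i j; rewrite !mxE.
transitivity (\sum_k \prod_s (B s (g i s) (g k s) * B' s (g k s) (g j s))).
  by apply: eq_bigr => k _; rewrite !mxE -big_split.
transitivity (\sum_(f : {ffun S -> 'I_N})
    \prod_s (B s (g i s) (f s) * B' s (f s) (g j s))).
  by rewrite [RHS](reindex g)//; exact: onW_bij.
rewrite -(bigA_distr_bigA (fun s x => B s (g i s) x * B' s x (g j s))).
by apply: eq_bigr => s _; rewrite mxE.
Qed.

Lemma tens_diag (d : S -> 'rV[C]_N) :
  tens (fun s => diag_mx (d s)) = diag_mx (\row_m \prod_s d s 0 (g m s)).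
Proof.
apply/matrixP => i j; rewrite !mxE.
have [<-|nij] := eqVneq i j.
  by rewrite mulr1n; apply: eq_bigr => s _; rewrite !mxE eqxx mulr1n.
have [s nes] : exists s, g i s != g j s.
  apply/existsP; apply: contraR nij; rewrite negb_exists => /forallP e.
  apply/eqP; apply: (bij_inj g_bij); apply/ffunP => s.
  by apply/eqP; have := e s; rewrite negbK.
by rewrite (bigD1 s)//= !mxE (negbTE nes) mul0r.
Qed.

Lemma tens1 : tens (fun _ => 1%:M) = 1%:M.
Proof.
rewrite -[in RHS]diag_const_mx.
transitivity (tens (fun _ => diag_mx (const_mx 1))).
  by apply: eq_tens => s; rewrite diag_const_mx.
rewrite tens_diag; congr diag_mx; apply/rowP => j; rewrite !mxE.
by rewrite big1// => s _; rewrite mxE.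
Qed.

Lemma tens_adj B : (tens B)^t* = tens (fun s => (B s)^t*).
Proof.
apply/matrixP => i j; rewrite !mxE rmorph_prod.
by apply: eq_bigr => s _; rewrite !mxE.
Qed.

Definition slot s (X : 'M[C]_N) : 'M[C]_M :=
  tens (fun r => if r == s then X else 1%:M).

Lemma slot_linear s : linear (slot s).
Proof.
move=> a X Y; apply/matrixP => i j; rewrite !mxE.
rewrite !(bigD1 s (P := predT))//= eqxx.
set p := \prod_(_ | _) _.
rewrite (_ : \prod_(i0 | i0 != s) _ = p); last first.
  by apply: eq_bigr => r /negbTE ->.
rewrite (_ : \prod_(i0 | i0 != s) _ = p); last first.
  by apply: eq_bigr => r /negbTE ->.
by rewrite !mxE mulrDl mulrA.
Qed.

HB.instance Definition _ s :=
  GRing.isLinear.Build C 'M[C]_N 'M[C]_M _ (slot s) (slot_linear s).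

Lemma slot_mul s X Y : slot s X *m slot s Y = slot s (X *m Y).
Proof.
by rewrite tens_mul; apply: eq_tens => r; case: ifP; rewrite ?mulmx1.
Qed.

Lemma slot_comm s r X Y : s != r -> slot s X *m slot r Y = slot r Y *m slot s X.
Proof.
move=> sr; rewrite !tens_mul; apply: eq_tens => q.
have [->|] := eqVneq q s; first by rewrite (negbTE sr) mulmx1 mul1mx.
by case: ifP; rewrite ?mulmx1 ?mul1mx.
Qed.

Lemma tens_slot B B' s X : (forall r, B r *m B' r = 1%:M) ->
  tens B *m slot s X *m tens B' = slot s (B s *m X *m B' s).
Proof.
move=> BB; rewrite !tens_mul; apply: eq_tens => r.
by have [->|_] := eqVneq r s; rewrite ?mulmx1 ?BB.
Qed.

Lemma slot_adj s X : (slot s X)^t* = slot s (X^t*).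
Proof.
rewrite tens_adj; apply: eq_tens => r; case: ifP => // _.
by rewrite trmx1 map_mx1.
Qed.

Lemma slot_diag s (d : 'rV[C]_N) : slot s (diag_mx d) = diag_mx (\row_m d 0 (g m s)).
Proof.
transitivity (tens (fun r => diag_mx (if r == s then d else const_mx 1))).
  by apply: eq_tens => r; case: ifP; rewrite ?diag_const_mx.
rewrite tens_diag; congr diag_mx; apply/rowP => j; rewrite !mxE.
rewrite (bigD1 s)//= eqxx big1 ?mulr1// => r /negbTE ->.
by rewrite mxE.
Qed.

Variable eps : S -> bool.

Definition tau (U : 'M[C]_N) : 'M[C]_M :=
  tens (fun s => if eps s then U else map_mx Num.conj U).

Lemma tau_mul U V : tau U *m tau V = tau (U *m V).
Proof. by rewrite tens_mul; apply: eq_tens => s; case: ifP; rewrite ?map_mxM. Qed.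

Lemma tau1 : tau 1%:M = 1%:M.
Proof. by rewrite -tens1; apply: eq_tens => s; rewrite map_mx1 if_same. Qed.

Lemma tau_adj U : (tau U)^t* = tau (U^t*).
Proof. by rewrite tens_adj; apply: eq_tens => s; case: ifP; rewrite ?map_trmx. Qed.

(** The differential of U -> conj(U) at a skew-Hermitian X is conj(X) = - X^T; the transposed form
    is linear over C and so extends to every matrix. *)
Definition dual_sign s (X : 'M[C]_N) := if eps s then X else - X^T.

Lemma dual_sign_linear s : linear (dual_sign s).
Proof.
move=> a X Y; rewrite /dual_sign; case: ifP => // _.
by rewrite linearP opprD scalerN.
Qed.
HB.instance Definition _ s :=
  GRing.isLinear.Build C 'M[C]_N 'M[C]_N _ (dual_sign s) (dual_sign_linear s).

Definition lie (X : 'M[C]_N) : 'M[C]_M := \sum_s slot s (dual_sign s X).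

Lemma lie_linear : linear lie.
Proof.
move=> a X Y; rewrite /lie scaler_sumr -big_split /=.
by apply: eq_bigr => s _; rewrite !linearP.
Qed.
HB.instance Definition _ :=
  GRing.isLinear.Build C 'M[C]_N 'M[C]_M _ lie lie_linear.

Lemma lie_adj X : (lie X)^t* = lie (X^t*).
Proof.
rewrite /lie raddf_sum /= raddf_sum /=; apply: eq_bigr => s _.
rewrite slot_adj /dual_sign; case: ifP => // _; congr slot.
by rewrite linearN /= map_mxN map_trmx.
Qed.

(** Terms in two different slots commute and drop out of the commutator; within one slot both X -> X
    and X -> - X^T preserve brackets. *)
Lemma lie_bracket X Y : lie X *m lie Y - lie Y *m lie X = lie (X *m Y - Y *m X).
Proof.
have E A B : lie A *m lie B = \sum_s slot s (dual_sign s A *m dual_sign s B) +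
   \sum_s \sum_(r | r != s) slot s (dual_sign s A) *m slot r (dual_sign r B).
  rewrite -big_split/= {1}/lie mulmx_suml; apply: eq_bigr => s _.
  by rewrite /lie mulmx_sumr (bigD1 s)//= slot_mul.
rewrite !E opprD addrACA [X in _ + X](_ : _ = 0) ?addr0.
  rewrite -sumrB /lie; apply: eq_bigr => s _; rewrite -linearB/=; congr slot.
  rewrite /dual_sign; case: ifP => // _.
  by rewrite !mulmxN !mulNmx !opprK linearB/= !trmx_mul opprB.
apply/eqP; rewrite subr_eq0; apply/eqP.
rewrite [RHS](exchange_big_dep predT)//=; apply: eq_bigr => s _.
apply: eq_big => [r|r rs]; first by rewrite eq_sym.
by rewrite slot_comm// eq_sym.
Qed.

(** Conjugation changes only the slot that holds X; in a dual slot conj(U) and U^T surround X^T,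
    which is the transpose of the conjugated matrix. *)
Lemma tau_lie U X : U \is unitarymx ->
  tau U *m lie X *m (tau U)^t* = lie (U *m X *m U^t*).
Proof.
move=> /unitarymxP Uu; rewrite tau_adj /lie mulmx_sumr mulmx_suml.
apply: eq_bigr => s _; rewrite tens_slot; last first.
  by move=> r; case: ifP => // _; rewrite -map_mxM Uu map_mx1.
rewrite /dual_sign; case: ifP => // _; congr slot.
rewrite !trmx_mul mulmxN mulNmx; congr (- _).
rewrite -mulmxA map_trmx trmxK; set V := map_mx _ (_ ^t*).
by rewrite (_ : V = U^T)//; apply/matrixP => i j; rewrite !mxE conjCK.
Qed.

End Tensor.

(** * Casimir operator and weights *)

Section Casimir.
Variables (C : numClosedFieldType) (N M : nat) (S : finType).
Variable g : 'I_M -> {ffun S -> 'I_N}.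
Hypothesis g_bij : bijective g.
Variable eps : S -> bool.
Local Notation L := (lie g eps).
Local Notation E i j := (delta_mx i j : 'M[C]_N).

Lemma delta_mulmx (i j : 'I_N) (X : 'M[C]_N) :
  E i j *m X = \sum_k X j k *: E i k.
Proof.
apply/matrixP => a b; rewrite summxE !mxE (bigD1 j)//= big1 => [|c /negbTE nc].
  rewrite (bigD1 b)//= big1 => [|c /negbTE nc]; rewrite !mxE ?eqxx ?andbT ?addr0.
    by rewrite mulrC.
  by rewrite [b == c]eq_sym nc andbF mulr0.
by rewrite mxE nc andbF mul0r.
Qed.

Lemma mulmx_delta (i j : 'I_N) (X : 'M[C]_N) :
  X *m E i j = \sum_k X k i *: E k j.
Proof.
apply/matrixP => a b; rewrite summxE !mxE (bigD1 i)//= big1 => [|c /negbTE nc].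
  rewrite (bigD1 a)//= big1 => [|c /negbTE nc]; rewrite !mxE ?eqxx ?andbT ?addr0//=.
  by rewrite eq_sym nc mulr0.
by rewrite mxE nc mulr0.
Qed.

(** The tensor sum_{ij} E_ij (x) E_ji is the swap, so a matrix multiplying one leg can be moved to
    the other. Arbitrary linear maps [L1], [L2] allow [lie] to be precomposed with
    multiplications. *)
Lemma delta_shift_r (L1 L2 : {linear 'M[C]_N -> 'M[C]_M}) X :
  \sum_i \sum_j L1 (E i j *m X) *m L2 (E j i) =
  \sum_i \sum_j L1 (E i j) *m L2 (X *m E j i).
Proof.
apply: eq_bigr => i _.
transitivity (\sum_j \sum_k X j k *: (L1 (E i k) *m L2 (E j i))).
  apply: eq_bigr => j _; rewrite delta_mulmx linear_sum mulmx_suml.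
  by apply: eq_bigr => k _; rewrite linearZ scalemxAl.
rewrite exchange_big; apply: eq_bigr => j _ /=.
rewrite mulmx_delta linear_sum mulmx_sumr.
by apply: eq_bigr => k _; rewrite linearZ scalemxAr.
Qed.

Lemma delta_shift_l (L1 L2 : {linear 'M[C]_N -> 'M[C]_M}) X :
  \sum_i \sum_j L1 (X *m E i j) *m L2 (E j i) =
  \sum_i \sum_j L1 (E i j) *m L2 (E j i *m X).
Proof.
rewrite exchange_big [RHS]exchange_big; apply: eq_bigr => j _ /=.
transitivity (\sum_i \sum_k X k i *: (L1 (E k j) *m L2 (E j i))).
  apply: eq_bigr => i _; rewrite mulmx_delta linear_sum mulmx_suml.
  by apply: eq_bigr => k _; rewrite linearZ scalemxAl.
rewrite exchange_big; apply: eq_bigr => i _ /=.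
rewrite delta_mulmx linear_sum mulmx_sumr.
by apply: eq_bigr => k _; rewrite linearZ scalemxAr.
Qed.

Definition casimir : 'M[C]_M := \sum_i \sum_j L (E i j) *m L (E j i).

(** By the Leibniz rule the commutator with [L X] gives four sums; the two shift lemmas identify
    them in pairs of opposite sign. *)
Lemma casimir_lie X : casimir *m L X = L X *m casimir.
Proof.
apply/eqP; rewrite -subr_eq0 /casimir mulmx_suml mulmx_sumr -sumrB.
transitivity (\sum_i \sum_j L (E i j *m X) *m L (E j i) -
  \sum_i \sum_j L (X *m E i j) *m L (E j i) +
  (\sum_i \sum_j L (E i j) *m L (E j i *m X) -
   \sum_i \sum_j L (E i j) *m L (X *m E j i)) == 0); last first.
  by rewrite delta_shift_l -delta_shift_r addrA subrK subrr eqxx.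
congr (_ == 0); rewrite -!sumrB -big_split/=; apply: eq_bigr => i _.
rewrite mulmx_suml mulmx_sumr -!sumrB -big_split/=; apply: eq_bigr => j _.
rewrite -mulmxBl -mulmxBr -!linearB/= -!(lie_bracket g_bij) mulmxBl mulmxBr.
by rewrite !mulmxA addrC addrA subrK.
Qed.

Lemma delta_mx_adj i j : (E i j)^t* = E j i.
Proof.
by apply/matrixP => a b; rewrite !mxE andbC; case: (_ && _); rewrite ?conjC0 ?conjC1.
Qed.

Lemma casimir_adj : casimir^t* = casimir.
Proof.
rewrite /casimir !raddf_sum; apply: eq_bigr => i _; rewrite !raddf_sum.
by apply: eq_bigr => j _ /=; rewrite trmx_mul map_mxM /= !lie_adj !delta_mx_adj.
Qed.

Lemma tau_unitary (U : 'M[C]_N) : U \is unitarymx -> tau g eps U \is unitarymx.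
Proof.
by move=> /unitarymxP Uu; apply/unitarymxP; rewrite tau_adj tau_mul// Uu tau1.
Qed.

(** Conjugation replaces E_ij and E_ji by their conjugates under U. Shifting first the adjoint of U
    and then U itself out of the first leg makes each meet its inverse in the second leg. *)
Lemma casimir_tau (U : 'M[C]_N) : U \is unitarymx ->
  tau g eps U *m casimir *m (tau g eps U)^t* = casimir.
Proof.
move=> Uu; have TT := tau_unitary Uu.
rewrite /casimir mulmx_sumr mulmx_suml.
transitivity (\sum_i \sum_j (L \o mulmx U) (E i j *m U^t*) *m
   (L \o mulmx U \o mulmxr (U^t*)) (E j i)).
  apply: eq_bigr => i _; rewrite mulmx_sumr mulmx_suml; apply: eq_bigr => j _ /=.
  rewrite !mulmxA -!(tau_lie g_bij eps)// !mulmxA mulmxKtV//.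
rewrite (delta_shift_r (L \o mulmx U) (L \o mulmx U \o mulmxr (U^t*))) /=.
transitivity (\sum_i \sum_j L (U *m E i j) *m (L \o mulmxr (U^t*)) (E j i)).
  apply: eq_bigr => i _;  apply: eq_bigr => j _ /=.
  by rewrite !mulmxA (unitarymxP Uu) mul1mx.
rewrite (delta_shift_l _ (L \o mulmxr (U^t*))) /=.
apply: eq_bigr => i _;  apply: eq_bigr => j _ /=.
by rewrite -!mulmxA (unitarymxP Uu) mulmx1.
Qed.

Lemma casimir_tauC (U : 'M[C]_N) : U \is unitarymx ->
  tau g eps U *m casimir = casimir *m tau g eps U.
Proof.
by move=> Uu; rewrite -{2}(casimir_tau Uu) mulmxKtV// tau_unitary.
Qed.

(** The weight of the m-th basis vector for the diagonal torus, as [lie_delta_diag] shows. Its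
    integrality matters for the quadratic bound and for the angular averages. *)
Definition weight (m : 'I_M) (k : 'I_N) : int :=
  \sum_s (if eps s then 1 else -1) * (g m s == k)%:R.

Lemma lie_diag (d : 'rV[C]_N) :
  L (diag_mx d) = diag_mx (\row_m \sum_k d 0 k * (weight m k)%:~R).
Proof.
transitivity (\sum_s (if eps s then 1 else -1) *: diag_mx (\row_m d 0 (g m s))).
  apply: eq_bigr => s _; rewrite /dual_sign; case: ifP => _.
    by rewrite (slot_diag g_bij) scale1r.
  by rewrite tr_diag_mx linearN /= (slot_diag g_bij) scaleN1r.
apply/matrixP => i j; rewrite summxE !mxE.
have [<-|nij] := eqVneq i j; last first.
  by rewrite big1// => s _; rewrite !mxE (negbTE nij) mulr0.
transitivity (\sum_s \sum_k (if eps s then 1 else -1) * d 0 k * (g i s == k)%:R).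
  apply: eq_bigr => s _; rewrite !mxE eqxx mulr1n (bigD1 (g i s))//= eqxx mulr1.
  by rewrite big1 ?addr0// => k /negbTE; rewrite eq_sym => ->; rewrite mulr0.
rewrite mulr1n exchange_big; apply: eq_bigr => k _ /=.
rewrite /weight rmorph_sum mulr_sumr; apply: eq_bigr => s _.
rewrite rmorphM /= mulrA; case: (eps s); case: (_ == _);
 by rewrite ?mul1r ?mulN1r ?mulr1 ?mulr0 ?mulrN1.
Qed.

Lemma lie_delta_diag k : L (E k k) = diag_mx (\row_m (weight m k)%:~R).
Proof.
have -> : E k k = diag_mx (delta_mx 0 k).
  apply/matrixP => a b; rewrite !mxE eqxx /=; have [<-|ab] := eqVneq a b.
    by rewrite mulr1n andbb.
  by rewrite mulr0n; case: (eqVneq a k) ab => //= ->; rewrite eq_sym => /negbTE ->.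
rewrite lie_diag; congr diag_mx; apply/rowP => q; rewrite !mxE.
rewrite (bigD1 k)//= mxE !eqxx mul1r big1 ?addr0// => r /negbTE nr.
by rewrite mxE nr andbF mul0r.
Qed.

(** [casimir] commutes with the diagonal matrices [L (E k k)], whose entries are the weights, so it
    has no entry between different weights. *)
Lemma casimir_weight m m' : casimir m m' != 0 -> weight m =1 weight m'.
Proof.
move=> nz k; have := casimir_lie (E k k).
rewrite lie_delta_diag mul_diag_mx mul_mx_diag => /matrixP/(_ m m').
by rewrite !mxE [RHS]mulrC => /(mulfI nz)/intr_inj.
Qed.

(** Read entrywise, [E_kk, E_ij] = ((k = i) - (k = j)) E_ij says that [L (E i j)] moves weights by
    the root e_i - e_j. *)
Lemma weight_shift i j m m' : L (E i j) m m' != 0 ->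
  forall k, weight m k = weight m' k + (k == i)%:R - (k == j)%:R.
Proof.
move=> nz k; set x := L (E i j) m m'.
have e : (weight m k)%:~R * x - x * (weight m' k)%:~R =
    x * (k == i)%:R - x * (k == j)%:R.
  have := lie_bracket g_bij eps (E k k) (E i j).
  rewrite !mul_delta_mx_cond linearB/= !raddfMn/= lie_delta_diag mul_diag_mx mul_mx_diag.
  move/matrixP/(_ m m'); rewrite !mxE !mulmxnE => ->.
  rewrite /x [k == j]eq_sym; case: (eqVneq k i) => [<-|_]; case: (eqVneq j k) => [<-|_];
  by rewrite !mxE ?mulr1n ?mulr0n ?mulr1 ?mulr0 ?oppr0 ?subr0 ?addr0.
apply: (@intr_inj C); apply: (mulIf nz).
rewrite -[LHS](subrK (x * (weight m' k)%:~R)) e intrB intrD !natz -!pmulrn.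
rewrite -/x; ring.
Qed.

End Casimir.

(** * Lower bounds on the Casimir eigenvalue *)

Section Spread.
Variables (N : nat).
Implicit Type h : 'I_N -> int.

(* Twice the Casimir eigenvalue of a dominant weight h. *)
Definition spread h : int := 2 * \sum_i h i ^+ 2 + \sum_i \sum_j `|h i - h j|.

(** Cauchy-Schwarz gives sum h_i^2 >= K^2 / N, and since the h_j sum to 0 the triangle inequality
    gives sum_j |h_i - h_j| >= N |h_i|. A factor N clears the denominator. *)
Lemma spread_ge_linear h : \sum_i h i = 0 ->
  N%:R * (N%:R * \sum_i `|h i|) + 2 * (\sum_i `|h i|) ^+ 2 <= N%:R * spread h.
Proof.
move=> h0; rewrite /spread [leRHS]mulrDr addrC; apply: lerD.
  have : 0 <= \sum_i \sum_j (`|h i| - `|h j|) ^+ 2 :> int.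
    by apply: sumr_ge0 => i _; apply: sumr_ge0 => j _; exact: sqr_ge0.
  rewrite (_ : \sum_i _ = 2 * (N%:R * \sum_i h i ^+ 2) - 2 * (\sum_i `|h i|) ^+ 2).
    by rewrite subr_ge0 [leRHS]mulrCA.
  transitivity (\sum_i \sum_j (h i ^+ 2 + h j ^+ 2 - 2 * (`|h i| * `|h j|))).
    apply: eq_bigr => i _; apply: eq_bigr => j _.
    rewrite sqrrB !real_normK ?num_real// -mulr_natl addrAC; ring.
  have -> : (\sum_i `|h i|) ^+ 2 = \sum_i \sum_j `|h i| * `|h j|.
    by rewrite expr2 mulr_suml; apply: eq_bigr => i _; rewrite mulr_sumr.
  have cst x : \sum_(i < N) x = N%:R * x :> int.
    by rewrite sumr_const card_ord mulr_natl.
  under eq_bigr do rewrite sumrB big_split /= cst -mulr_sumr.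
  rewrite sumrB big_split /= -!mulr_sumr cst; ring.
rewrite ler_wpM2l// mulr_sumr; apply: ler_sum => i _.
apply: le_trans (ler_norm_sum _ _ _).
by rewrite sumrB h0 subr0 sumr_const card_ord mulr_natl normrMn.
Qed.

(** Opposite signs or a zero give equality. For nonzero a, b of equal sign the left side is |a| +
    |b| - 2 |a| |b|, at most the distance because the larger absolute value is at least 1. The term
    a b is kept since it cancels on summation over a weight of sum 0. *)
Lemma abs_sub_ge (a b : int) : `|a| + `|b| - `|a| * `|b| - a * b <= `|a - b|.
Proof.
case: (ger0P a) => a0; case: (ger0P b) => b0.
- case: (ler0P (a - b)) => ab; nia.
- rewrite ger0_norm; nia.
- rewrite ler0_norm; nia.
- case: (ler0P (a - b)) => ab; nia.
Qed.

(** Integrality gives h_i^2 >= |h_i|; the pairs are handled by [abs_sub_ge], whose terms h_i h_j add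
    up to the square of sum h = 0. *)
Lemma spread_ge_quadratic h : \sum_i h i = 0 ->
  2 * \sum_i `|h i| + 2 * N%:R * \sum_i `|h i| - (\sum_i `|h i|) ^+ 2 <= spread h.
Proof.
move=> h0; rewrite /spread -addrA; apply: lerD.
  rewrite ler_wpM2l//; apply: ler_sum => i _.
  have := abszE (h i); nia.
have cst x : \sum_(i < N) x = N%:R * x :> int.
  by rewrite sumr_const card_ord mulr_natl.
have <- : \sum_i \sum_j (`|h i| + `|h j| - `|h i| * `|h j| - h i * h j) =
  2 * N%:R * (\sum_i `|h i|) - (\sum_i `|h i|) ^+ 2.
  under eq_bigr do rewrite !sumrB big_split /= cst -!mulr_sumr.
  rewrite !sumrB big_split /= -!mulr_sumr cst -!mulr_suml h0; ring.
by apply: ler_sum => i _; apply: ler_sum => j _; exact: abs_sub_ge.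
Qed.

Lemma sum_transfer (F : int -> int) h i j : i != j ->
  \sum_k F (h k + (k == i)%:R - (k == j)%:R) =
  \sum_k F (h k) + (F (h i + 1) - F (h i)) + (F (h j - 1) - F (h j)).
Proof.
move=> ij; rewrite !(bigD1 i (P := predT))//= !(bigD1 j (P := fun k => k != i)) 1?eq_sym//=.
rewrite !eqxx [j == i]eq_sym (negbTE ij) subr0 addr0.
rewrite (eq_bigr (fun k => F (h k))).
  ring.
by move=> k /andP[/negbTE -> /negbTE ->]; rewrite addr0 subr0.
Qed.

Lemma abs_transfer_ge0 (a b : int) :
  b <= a -> 0 <= `|a + 1| - `|a| + (`|b - 1| - `|b|).
Proof. lia. Qed.

Lemma sqr_transfer_gt0 (a b : int) :
  b <= a -> 0 < (a + 1) ^+ 2 - a ^+ 2 + ((b - 1) ^+ 2 - b ^+ 2).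
Proof. nia. Qed.

End Spread.

(** * Dominant weights of a Casimir eigenspace *)

Section DominantWeight.
Variables (C : numClosedFieldType) (N M : nat) (S : finType).
Variable g : 'I_M -> {ffun S -> 'I_N}.
Hypothesis g_bij : bijective g.
Variable eps : S -> bool.
Hypothesis eps_balanced : \sum_s (if eps s then 1 else -1) = 0 :> int.
Local Notation L := (lie g eps).
Local Notation E i j := (delta_mx i j : 'M[C]_N).
Local Notation cas := (casimir C g eps).
Local Notation wt := (weight g eps).

Lemma sum_weight m : \sum_k wt m k = 0.
Proof.
rewrite /weight exchange_big /= -[RHS]eps_balanced; apply: eq_bigr => s _.
rewrite -mulr_sumr (bigD1 (g m s))//= eqxx big1 ?addr0 ?mulr1// => k /negbTE.
by rewrite eq_sym => ->.
Qed.

Lemma sum_abs_weight m : \sum_k `|wt m k| <= #|S|%:R.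
Proof.
apply: (@le_trans _ _ (\sum_k \sum_s (g m s == k)%:R)).
  apply: ler_sum => k _; apply: le_trans (ler_norm_sum _ _ _) _.
  by apply: ler_sum => s _; case: (eps s); case: (_ == _).
rewrite exchange_big /= -sum1_card natr_sum; apply: ler_sum => s _.
rewrite (bigD1 (g m s))//= eqxx big1 ?addr0// => k /negbTE.
by rewrite eq_sym => ->.
Qed.

(* h maximizes sum |h_k|, then sum h_k^2, over the weights of the c-eigenspace: transferring
   a unit from j to i with h_j <= h_i never decreases the former and increases the latter. *)
Lemma dominant_weight (c : C) (x : 'cV[C]_M) : x != 0 -> cas *m x = c *: x ->
  exists h : 'I_N -> int, [/\ \sum_k h k = 0, \sum_k `|h k| <= #|S|%:R,
    2 * c = (spread h)%:~R &
    forall (y : 'cV[C]_M) m, cas *m y = c *: y -> y m 0 != 0 ->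
      \sum_k `|wt m k| <= \sum_k `|h k| ].
Proof.
move=> x0 casx.
(* Coordinates that occur in some c-eigenvector; their weights are the weights of the eigenspace. *)
pose supp m := `[< exists y : 'cV[C]_M, cas *m y = c *: y /\ y m 0 != 0 >].
have [m1 supp1] : exists m, supp m.
  have /cV0Pn[m xm] := x0.
  by exists m; apply/asboolP; exists x.
pose absn m : nat := absz (\sum_k `|wt m k|).
pose sqn m : nat := absz (\sum_k wt m k ^+ 2).
have absnE m : (absn m)%:Z = \sum_k `|wt m k|.
  by rewrite abszE ger0_norm// sumr_ge0.
have sqnE m : (sqn m)%:Z = \sum_k wt m k ^+ 2.
  by rewrite abszE ger0_norm// sumr_ge0// => k _; exact: sqr_ge0.
case: (arg_maxnP absn supp1) => m2 supp2 max2.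
pose supp' m := supp m && (absn m == absn m2).
have supp'2 : supp' m2 by rewrite /supp' supp2 eqxx.
case: (arg_maxnP sqn supp'2) => m3 /andP[/asboolP[y [casy ym3]] /eqP abs3] max3.
pose h := wt m3.
exists h; split.
- exact: sum_weight.
- exact: sum_abs_weight.
(* The component of y of weight h: still an eigenvector, because the Casimir does not mix weights,
   and nonzero at m3. *)
- pose w : 'cV[C]_M := \col_m (if [forall k, wt m k == h k] then y m 0 else 0).
  have wP m : w m 0 != 0 -> wt m =1 h.
    by rewrite mxE; case: ifP => [/'forall_eqP//|]; rewrite eqxx.
  have w0 : w != 0.
    apply: contra_neq ym3 => /colP/(_ m3); rewrite !mxE.
    by case: ifP => // /negbT /'forall_eqP; case.
  have casw : cas *m w = c *: w.
    apply/colP => m; move: casy => /colP/(_ m); rewrite !mxE => casy.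
    case: ifP => [/'forall_eqP e|/negbT ne].
      rewrite -casy; apply: eq_bigr => m' _; rewrite mxE.
      have [->|nz] := eqVneq (cas m m') 0; first by rewrite !mul0r.
      rewrite ifT//; apply/'forall_eqP => k.
      by rewrite -e (casimir_weight g_bij nz).
    rewrite mulr0 big1// => m' _; rewrite mxE.
    have [->|nz] := eqVneq (cas m m') 0; first by rewrite !mul0r.
    rewrite ifN ?mulr0//; apply: contra ne => /'forall_eqP e; apply/'forall_eqP => k.
    by rewrite -e (casimir_weight g_bij nz).
  (* A nonzero coordinate of E_ij w would belong to the support with weight h + e_i - e_j,
     contradicting the successive maximality of h. *)
  have kill i j : i != j -> h j <= h i -> L (E i j) *m w = 0.
    move=> ij hij; apply/eqP/negPn/negP => /cV0Pn[m].
    rewrite mxE => nz.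
    have suppm : supp m.
      apply/asboolP; exists (L (E i j) *m w); rewrite mxE; split=> //.
      by rewrite mulmxA casimir_lie// -mulmxA casw scalemxAr.
    have [m' nzm'] : exists m', L (E i j) m m' * w m' 0 != 0.
      apply/existsP; apply: contra_neqT nz; rewrite negb_exists => /forallP e.
      by apply: big1 => m' _; apply/eqP; have := e m'; rewrite negbK.
    have /andP[Lnz wnz] : (L (E i j) m m' != 0) && (w m' 0 != 0).
      by rewrite -negb_or -mulf_eq0.
    have wtm k : wt m k = h k + (k == i)%:R - (k == j)%:R.
      by rewrite (weight_shift g_bij Lnz) (wP _ wnz).
    have abs_ge : (absn m3 <= absn m)%N.
      rewrite -lez_nat !absnE; under [leRHS]eq_bigr do rewrite wtm.
      rewrite (sum_transfer (fun z => `|z|))// -addrA lerDl; exact: abs_transfer_ge0.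
    have absm : absn m = absn m3.
      by apply/eqP; rewrite eqn_leq abs_ge andbT abs3; exact: max2.
    have : (sqn m <= sqn m3)%N by apply: max3; rewrite /supp' suppm absm abs3 eqxx.
    apply/negP; rewrite -ltnNge -ltz_nat !sqnE.
    under [ltRHS]eq_bigr do rewrite wtm.
    rewrite (sum_transfer (fun z => z ^+ 2))// -addrA ltrDl; exact: sqr_transfer_gt0.
  (* Doubling makes each pair (i, j) appear in both orders; for i <> j one of the two vanishes by
     [kill]. *)
  have cas2 : 2 *: (cas *m w) =
      \sum_i \sum_j (L (E i j) *m (L (E j i) *m w) + L (E j i) *m (L (E i j) *m w)).
    rewrite scaler_nat mulr2n {1}/casimir.
    rewrite /casimir [X in _ + X *m w]exchange_big !mulmx_suml -big_split /=.
    apply: eq_bigr => i _; rewrite !mulmx_suml -big_split /=; apply: eq_bigr => j _.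
    by rewrite !mulmxA.
  have wtw k : L (E k k) *m w = (h k)%:~R *: w.
    rewrite lie_delta_diag// mul_diag_mx; apply/colP => m; rewrite !mxE.
    case: ifP => [/'forall_eqP e|]; last by rewrite !mulr0.
    by rewrite e.
  (* With one order vanishing, the other equals the commutator [L (E i i) - L (E j j)], whose value
     on w is h_i - h_j. *)
  have half i j : i != j -> h j <= h i ->
     L (E i j) *m (L (E j i) *m w) + L (E j i) *m (L (E i j) *m w) =
     (`|h i - h j|)%:~R *: w.
    move=> ij hij; have z : L (E j i) *m (L (E i j) *m w) = 0 by rewrite kill// mulmx0.
    rewrite z addr0 -[LHS]subr0 -[X in _ - X]z !mulmxA -mulmxBl lie_bracket//.
    rewrite !mul_delta_mx linearB/=.
    by rewrite mulmxBl !wtw -scalerBl ger0_norm ?subr_ge0// intrB.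
  have pair i j :
     L (E i j) *m (L (E j i) *m w) + L (E j i) *m (L (E i j) *m w) =
     (2 * (if j == i then h i ^+ 2 else 0) + `|h i - h j|)%:~R *: w.
    have [->|ji] := eqVneq j i.
      rewrite subrr normr0 addr0 wtw -scalemxAr wtw scalerA -scalerDl.
      by rewrite -intrM -intrD; congr (_%:~R *: _); ring.
    rewrite mulr0 add0r; have [hij|hij] := boolP (h j <= h i).
      by apply: half => //; rewrite eq_sym.
    by rewrite addrC distrC; apply: half => //; rewrite ltW // ltNge.
  have : (2 * c) *: w = (spread h)%:~R *: w.
    rewrite -scalerA -casw cas2.
    under eq_bigr do under eq_bigr do rewrite pair.
    under eq_bigr do rewrite -scaler_suml.
    rewrite -scaler_suml; congr (_ *: _).
    under eq_bigr do rewrite -rmorph_sum.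
    rewrite -rmorph_sum /spread mulr_sumr -big_split /=; congr (_%:~R).
    apply: eq_bigr => i _; rewrite big_split /= -mulr_sumr; congr (2 * _ + _).
    by rewrite -big_mkcond big_pred1_eq.
  have /cV0Pn[m wm] := w0.
  by move/colP/(_ m); rewrite mxE [RHS]mxE => /(mulIf wm).
- move=> z m casz zm; rewrite -!absnE lez_nat abs3; apply: max2.
  by apply/asboolP; exists z.
Qed.

End DominantWeight.

(** * Hermitian forms *)

Section Hermitian.
Variable C : numClosedFieldType.

Definition dotc n (x y : 'cV[C]_n) : C := (x^t* *m y) 0 0.
(** Squared and valued in C, so that the spectral arguments need no square roots. *)
Definition sqnorm n (x : 'cV[C]_n) : C := \sum_i `|x i 0| ^+ 2.

Lemma dotc_self n (x : 'cV[C]_n) : dotc x x = sqnorm x.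
Proof. by rewrite /dotc mxE; apply: eq_bigr => i _; rewrite !mxE mulrC normCK. Qed.

Lemma sqnorm_ge0 n (x : 'cV[C]_n) : 0 <= sqnorm x.
Proof. by apply: sumr_ge0 => i _; rewrite exprn_ge0. Qed.

Lemma sqnorm_eq0 n (x : 'cV[C]_n) : (sqnorm x == 0) = (x == 0).
Proof.
apply/eqP/eqP => [x0|->]; last by apply: big1 => i _; rewrite mxE normr0 expr0n.
apply/colP => i; rewrite mxE; apply/eqP.
have /psumr_eq0P : \sum_i `|x i 0| ^+ 2 = 0 by [].
by move=> /(_ (fun i _ => exprn_ge0 _ (normr_ge0 _)))/(_ i isT)/eqP;
  rewrite expf_eq0 normr_eq0.
Qed.

Lemma sqnorm0 n : sqnorm (0 : 'cV[C]_n) = 0.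
Proof. by apply/eqP; rewrite sqnorm_eq0. Qed.

Lemma dotc_mulmx n m (A : 'M[C]_(n, m)) x y : dotc x (A *m y) = dotc (A^t* *m x) y.
Proof. by rewrite /dotc trmx_mul map_mxM /= trmxCK mulmxA. Qed.

Lemma dotcBr n (x y z : 'cV[C]_n) : dotc x (y - z) = dotc x y - dotc x z.
Proof. by rewrite /dotc mulmxBr !mxE. Qed.

Lemma dotcZr n (x y : 'cV[C]_n) a : dotc x (a *: y) = a * dotc x y.
Proof. by rewrite /dotc -scalemxAr mxE. Qed.

Lemma dotcBl n (x y z : 'cV[C]_n) : dotc (y - z) x = dotc y x - dotc z x.
Proof. by rewrite /dotc linearB/= map_mxB mulmxBl !mxE. Qed.

Lemma dotcZl n (x y : 'cV[C]_n) a : dotc (a *: y) x = a^* * dotc y x.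
Proof. by rewrite /dotc linearZ/= map_mxZ -scalemxAl mxE. Qed.

Lemma dotc_sumr n (I : finType) (P : pred I) (x : 'cV[C]_n) (F : I -> 'cV[C]_n) :
  dotc x (\sum_(i | P i) F i) = \sum_(i | P i) dotc x (F i).
Proof. by rewrite /dotc mulmx_sumr summxE. Qed.

Lemma sqnorm_mulmx n m (A : 'M[C]_(n, m)) x :
  sqnorm (A *m x) = dotc x (A^t* *m (A *m x)).
Proof. by rewrite -dotc_self [RHS]dotc_mulmx trmxCK. Qed.

Lemma sqnorm_unitary n (Q : 'M[C]_n) x : Q \is unitarymx -> sqnorm (Q *m x) = sqnorm x.
Proof.
move=> Qu; rewrite sqnorm_mulmx mulmxA -dotc_self; congr dotc.
have : Q^t* \is unitarymx by rewrite trmxC_unitary.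
by move/unitarymxP; rewrite trmxCK => ->; rewrite mul1mx.
Qed.

Lemma unitarymxK n (Q : 'M[C]_n) : Q \is unitarymx -> Q^t* *m Q = 1%:M.
Proof.
move=> Qu; have : Q^t* \is unitarymx by rewrite trmxC_unitary.
by move/unitarymxP; rewrite trmxCK.
Qed.

Lemma dotc_diag n (r : 'rV[C]_n) (w : 'cV[C]_n) :
  dotc w (diag_mx r *m w) = \sum_i r 0 i * `|w i 0| ^+ 2.
Proof.
rewrite /dotc mxE; apply: eq_bigr => i _; rewrite mul_diag_mx !mxE normCK.
by rewrite mulrCA [w i 0 * _]mulrC.
Qed.

Lemma sqnorm_diag n (r : 'rV[C]_n) (w : 'cV[C]_n) :
  sqnorm (diag_mx r *m w) = \sum_i `|r 0 i| ^+ 2 * `|w i 0| ^+ 2.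
Proof. by apply: eq_bigr => i _; rewrite mul_diag_mx mxE normrM exprMn. Qed.

Lemma normal_spectral n (A : 'M[C]_n) : A *m A^t* = A^t* *m A ->
  exists (Q : 'M[C]_n) (d : 'rV[C]_n), Q \is unitarymx /\ A = Q^t* *m diag_mx d *m Q.
Proof.
move=> An; exists (spectralmx A), (spectral_diag A); split.
  exact: spectral_unitarymx.
rewrite -invmx_unitary ?spectral_unitarymx//.
by apply/orthomx_spectralP/normalmxP.
Qed.

(** The eigenvalues of a Hermitian involution square to 1. They are returned as integers so that
    they can be exponents of phases and multiply weights. *)
Lemma involution_spectral n (A : 'M[C]_n) : A^t* = A -> A *m A = 1%:M ->
  exists (V : 'M[C]_n) (e : 'I_n -> int), [/\ V \is unitarymx,
    A = V^t* *m diag_mx (\row_k (e k)%:~R) *m V & forall k, e k = 1 \/ e k = -1].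
Proof.
move=> Ah A2; have [|V [d [Vu AE]]] := @normal_spectral n A; first by rewrite Ah.
have d_sq k : d 0 k ^+ 2 = 1.
  have : diag_mx d *m diag_mx d = 1%:M.
    have dE : diag_mx d = V *m A *m V^t*.
      by rewrite AE !mulmxA (unitarymxP Vu) mul1mx mulmxtVK.
    rewrite [in LHS]dE !mulmxA -(mulmxA (V *m A) (V^t*)) unitarymxK// mulmx1.
    by rewrite -(mulmxA V) A2 mulmx1 (unitarymxP Vu).
  by move=> /matrixP/(_ k k); rewrite mul_diag_mx !mxE eqxx mulr1n -expr2.
exists V, (fun k => if d 0 k == 1 then 1 else -1); split=> //.
  rewrite AE; congr (_ *m diag_mx _ *m _); apply/rowP => k; rewrite mxE.
  have /eqP := d_sq k; rewrite sqrf_eq1 => /orP[/eqP ->|/eqP ->]; first by rewrite eqxx.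
  by rewrite ifN// -subr_eq0 -opprD oppr_eq0 (_ : 1 + 1 = 2%:R)// pnatr_eq0.
by move=> k; case: ifP; [left|right].
Qed.

Lemma unitarymx_conj_diag n (V : 'M[C]_n) (d : 'rV[C]_n) : V \is unitarymx ->
  (forall k, `|d 0 k| = 1) -> V^t* *m diag_mx d *m V \is unitarymx.
Proof.
move=> Vu d1; rewrite !mul_unitarymx ?trmxC_unitary//.
apply/unitarymxP; rewrite tr_diag_mx map_diag_mx mulmx_diag -[RHS]diag_const_mx.
by congr diag_mx; apply/rowP => k; rewrite !mxE -normCK d1 expr1n.
Qed.

(** Pythagoras: [r] assigns each coordinate to a single summand, so at most one summand is nonzero
    there. *)
Lemma sqnorm_sum_orthogonal n (I : finType) (r : 'I_n -> I) (z : I -> 'cV[C]_n) :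
  (forall a i, z a i 0 != 0 -> r i = a) ->
  sqnorm (\sum_a z a) = \sum_a sqnorm (z a).
Proof.
move=> zr; rewrite /sqnorm exchange_big; apply: eq_bigr => i _ /=.
have z0 a : a != r i -> z a i 0 = 0.
  by move=> ar; apply/eqP; apply: contraTT ar => /zr ->; rewrite eqxx.
rewrite summxE [RHS](bigD1 (r i))//= [X in _ + X]big1 => [|a /z0 ->].
  rewrite addr0 (bigD1 (r i))//= [X in _ + X]big1 ?addr0// => a; exact: z0.
by rewrite normr0 expr0n.
Qed.

(* Decompose x along the eigenspaces of K: their images under D stay
   orthogonal to each other because D commutes with K. *)
Lemma sqnorm_le_eigenspaces n (D K : 'M[C]_n) (mu : C) :
  K^t* = K -> D *m K = K *m D ->
  (forall c x, K *m x = c *: x -> sqnorm (D *m x) <= mu * sqnorm x) ->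
  forall x, sqnorm (D *m x) <= mu * sqnorm x.
Proof.
move=> Kh DK bound x.
have [Q [k [Qu EK]]] :
    exists (Q : 'M[C]_n) (d : 'rV[C]_n), Q \is unitarymx /\ K = Q^t* *m diag_mx d *m Q.
  by apply: normal_spectral; rewrite Kh.
have QQ := unitarymxP Qu; have QQ' := unitarymxK Qu.
pose D' := Q *m D *m Q^t*.
have D'k : D' *m diag_mx k = diag_mx k *m D'.
  have -> : diag_mx k = Q *m K *m Q^t* by rewrite EK !mulmxA QQ mul1mx mulmxtVK.
  transitivity (Q *m (D *m K) *m Q^t*); last rewrite DK.
    by rewrite /D' !mulmxA -(mulmxA (Q *m D) (Q^t*)) QQ' mulmx1.
  by rewrite /D' !mulmxA -(mulmxA (Q *m K) (Q^t*)) QQ' mulmx1.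
(* [r i] represents the indices that share the eigenvalue of i and so labels the eigenspaces of K;
   the default i is never reached. *)
pose r i := odflt i [pick j | k 0 j == k 0 i].
have kr i : k 0 (r i) = k 0 i by rewrite /r; case: pickP => [j /eqP|].
have D'r i j : D' i j != 0 -> r i = r j.
  move=> nz; move/matrixP/(_ i j): D'k.
  rewrite mul_mx_diag mul_diag_mx mxE [RHS]mxE [RHS]mulrC => /(mulfI nz) kij.
  rewrite /r kij; case: pickP => [//|/(_ i)]; by rewrite eqxx.
pose y a : 'cV[C]_n := \col_i (if r i == a then (Q *m x) i 0 else 0).
have yr a i : y a i 0 != 0 -> r i = a.
  by rewrite mxE; case: ifP => [/eqP//|]; rewrite eqxx.
have y_sum : Q *m x = \sum_a y a.
  apply/colP => i; rewrite summxE (bigD1 (r i))//= big1 => [|a /negbTE ar].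
    by rewrite [in RHS]mxE eqxx addr0.
  by rewrite mxE eq_sym ar.
(* D' is block diagonal for [r], so the images of the components keep disjoint supports and their
   squared norms add. *)
have -> : sqnorm (D *m x) = \sum_a sqnorm (D' *m y a).
  rewrite -(sqnorm_unitary _ Qu) -(@sqnorm_sum_orthogonal _ _ r).
    by rewrite -mulmx_sumr -y_sum /D' !mulmxA mulmxKtV.
  move=> a i; rewrite mxE => nz.
  have [j nzj] : exists j, D' i j * y a j 0 != 0.
    apply/existsP; apply: contra_neqT nz; rewrite negb_exists => /forallP e.
    by apply: big1 => m' _; apply/eqP; have := e m'; rewrite negbK.
  move: nzj; rewrite mulf_eq0 negb_or => /andP[/D'r -> /yr //].
rewrite -(sqnorm_unitary x Qu) y_sum (sqnorm_sum_orthogonal yr) mulr_sumr.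
apply: ler_sum => a _.
rewrite -!mulmxA sqnorm_unitary// -(sqnorm_unitary (y a) (_ : Q^t* \is unitarymx)).
  apply: (bound (k 0 a)); rewrite EK !mulmxA -(mulmxA _ Q) QQ mulmx1 -mulmxA scalemxAr.
  congr (_ *m _); rewrite mul_diag_mx; apply/colP => i; rewrite mxE [RHS]mxE.
  have [->|/yr <-] := eqVneq (y a i 0) 0; first by rewrite !mulr0.
  by rewrite kr.
by rewrite trmxC_unitary.
Qed.

(* Positivity of the form of A at [mu y - A y] gives the bound. *)
Lemma sqnorm_le_form n (A K : 'M[C]_n) (c mu : C) : 0 < mu ->
  A^t* = A -> A *m K = K *m A ->
  (forall z, K *m z = c *: z -> 0 <= dotc z (A *m z) <= mu * sqnorm z) ->
  forall y, K *m y = c *: y -> sqnorm (A *m y) <= mu ^+ 2 * sqnorm y.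
Proof.
move=> mu0 Ah AK bound y Ky.
have KAy : K *m (A *m y) = c *: (A *m y) by rewrite mulmxA -AK -mulmxA Ky scalemxAr.
have /andP[_ by1] := bound _ Ky; have /andP[_ by2] := bound _ KAy.
have mur : mu^* = mu by apply/CrealP; exact: gtr0_real.
have /bound/andP[+ _] : K *m (mu *: y - A *m y) = c *: (mu *: y - A *m y).
  by rewrite mulmxBr -scalemxAr KAy Ky scalerBr !scalerA mulrC.
rewrite mulmxBr -scalemxAr dotcBl !dotcBr !dotcZl !dotcZr mur.
have -> : dotc y (A *m (A *m y)) = sqnorm (A *m y) by rewrite dotc_mulmx Ah dotc_self.
rewrite dotc_self => ge0.
have mul_by : mu * (mu * dotc y (A *m y)) <= mu * (mu * (mu * sqnorm y)).
  by rewrite !ler_pM2l.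
rewrite -(ler_pM2l mu0) -subr_ge0.
(* The first two brackets come from the upper bound at y and at A y; the third is the form of A at
   mu y - A y. *)
have -> : mu * (mu ^+ 2 * sqnorm y) - mu * sqnorm (A *m y) =
  (mu * (mu * (mu * sqnorm y)) - mu * (mu * dotc y (A *m y))) +
  (mu * sqnorm (A *m y) - dotc (A *m y) (A *m (A *m y))) +
  (mu * (mu * dotc y (A *m y)) - mu * sqnorm (A *m y) -
    (mu * sqnorm (A *m y) - dotc (A *m y) (A *m (A *m y)))) by ring.
by apply: addr_ge0 ge0; apply: addr_ge0; rewrite subr_ge0.
Qed.

End Hermitian.

(** * Spectral gap from the dominant weight *)

Section Invariants.
Variables (C : numClosedFieldType) (N M : nat) (S : finType).
Variable g : 'I_M -> {ffun S -> 'I_N}.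
Hypothesis g_bij : bijective g.
Variable eps : S -> bool.
Local Notation L := (lie g eps).
Local Notation E i j := (delta_mx i j : 'M[C]_N).
Local Notation cas := (casimir C g eps).
Local Notation wt := (weight g eps).

(** For |d_k| = 1 conjugation is inversion, so a dual slot contributes the exponent -1 and the
    exponents collect into the weight. *)
Lemma tau_diag (d : 'rV[C]_N) : (forall k, `|d 0 k| = 1) ->
  tau g eps (diag_mx d) = diag_mx (\row_m \prod_k (d 0 k ^ wt m k)%R).
Proof.
move=> d1; have d0 k : d 0 k != 0 by rewrite -normr_eq0 d1 oner_eq0.
transitivity (tens g (fun s => diag_mx (\row_k (d 0 k ^ (if eps s then 1 else -1 : int))%R))).
  apply: eq_tens => s; case: ifP => _.
    by congr diag_mx; apply/rowP => k; rewrite mxE expr1z.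
  rewrite map_diag_mx; congr diag_mx; apply/rowP => k; rewrite !mxE exprN1.
  by rewrite invC_norm d1 expr1n invr1 mul1r.
rewrite (tens_diag g_bij); congr diag_mx; apply/rowP => m; rewrite !mxE.
transitivity (\prod_s \prod_k (d 0 k ^ ((if eps s then 1 else -1) * (g m s == k)%:R : int))%R).
  apply: eq_bigr => s _; rewrite mxE (bigD1 (g m s))//= eqxx mulr1.
  rewrite [X in _ * X]big1 ?mulr1// => k /negbTE; rewrite eq_sym => ->.
  by rewrite mulr0 expr0z.
rewrite exchange_big; apply: eq_bigr => k _ /=; rewrite /weight.
by rewrite (big_morph (fun z => (d 0 k ^ z)%R) (fun a b => expfzDr a b (d0 k)) (expr0z _)).
Qed.

Lemma tau_conj_diag (V : 'M[C]_N) (d : 'rV[C]_N) : (forall k, `|d 0 k| = 1) ->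
  tau g eps (V^t* *m diag_mx d *m V) =
  (tau g eps V)^t* *m diag_mx (\row_m \prod_k (d 0 k ^ wt m k)%R) *m tau g eps V.
Proof. by move=> d1; rewrite -!tau_mul// tau_adj tau_diag. Qed.

Lemma lie_tauC (V Y : 'M[C]_N) : V \is unitarymx ->
  L (V *m Y *m V^t*) *m tau g eps V = tau g eps V *m L Y.
Proof. by move=> Vu; rewrite -tau_lie// mulmxKtV// tau_unitary. Qed.

Lemma lie_conj (V Y : 'M[C]_N) : V \is unitarymx ->
  L (V^t* *m Y *m V) = (tau g eps V)^t* *m L Y *m tau g eps V.
Proof.
move=> Vu; have Vu' : V^t* \is unitarymx by rewrite trmxC_unitary.
by have := tau_lie g_bij eps Y Vu'; rewrite trmxCK -tau_adj trmxCK.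
Qed.

Lemma lie_eq0 (x : 'cV[C]_M) : (forall i j, L (E i j) *m x = 0) -> forall X, L X *m x = 0.
Proof.
move=> Lx X; rewrite (matrix_sum_delta X) linear_sum mulmx_suml big1// => i _.
rewrite linear_sum mulmx_suml big1// => j _.
by rewrite linearZ -scalemxAl Lx scaler0.
Qed.

(** Diagonalise U. A vector killed by the Lie algebra stays so under [tau g eps V], hence lives on
    coordinates of weight 0, where the product of phases is 1. *)
Lemma tau_fixed (x : 'cV[C]_M) (U : 'M[C]_N) : U \is unitarymx ->
  (forall i j, L (E i j) *m x = 0) -> tau g eps U *m x = x.
Proof.
move=> Uu /lie_eq0 Lx.
have [V [d [Vu EU]]] : exists (Q : 'M[C]_N) (d : 'rV[C]_N),
    Q \is unitarymx /\ U = Q^t* *m diag_mx d *m Q.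
  by apply: normal_spectral; rewrite (unitarymxP Uu) unitarymxK.
have VV := unitarymxP Vu; have VV' := unitarymxK Vu.
have dE : diag_mx d = V *m U *m V^t* by rewrite EU !mulmxA VV mul1mx mulmxtVK.
have d1 k : `|d 0 k| = 1.
  have : diag_mx d \is unitarymx.
    by rewrite dE !mul_unitarymx// trmxC_unitary.
  move/unitarymxP/matrixP/(_ k k); rewrite mul_diag_mx !mxE eqxx !mulr1n -normCK.
  by move/eqP; rewrite sqrp_eq1 ?normr_ge0// => /eqP.
pose y := tau g eps V *m x.
have Ly X : L X *m y = 0.
  have VXV : V *m (V^t* *m X *m V) *m V^t* = X.
    by rewrite !mulmxA VV mul1mx mulmxtVK.
  have := lie_tauC (V^t* *m X *m V) Vu; rewrite VXV => e.
  by rewrite /y [LHS]mulmxA e -mulmxA Lx mulmx0.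
have diag_y : tau g eps (diag_mx d) *m y = y.
  rewrite tau_diag// mul_diag_mx; apply/colP => m; rewrite mxE [X in X * _]mxE.
  have [->|ym] := eqVneq (y m 0) 0; first by rewrite mulr0.
  rewrite big1 ?mul1r// => k _.
  have /colP/(_ m) := Ly (E k k).
  rewrite lie_delta_diag// mul_diag_mx mxE [X in X * _]mxE [RHS]mxE.
  by move/eqP; rewrite mulf_eq0 (negbTE ym) orbF intr_eq0 => /eqP ->; rewrite expr0z.
rewrite EU -!tau_mul// -!mulmxA -/y diag_y /y mulmxA -tau_adj.
by rewrite unitarymxK ?mul1mx// tau_unitary.
Qed.

End Invariants.

(** * Averaged kernel projectors over a complete family of involutions *)

Section MainBound.
Variables (C : numClosedFieldType) (N M : nat) (S : finType).
Variable g : 'I_M -> {ffun S -> 'I_N}.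
Hypothesis g_bij : bijective g.
Variable eps : S -> bool.
Hypothesis eps_balanced : \sum_s (if eps s then 1 else -1) = 0 :> int.
Local Notation L := (lie g eps).
Local Notation E i j := (delta_mx i j : 'M[C]_N).
Local Notation cas := (casimir C g eps).
Local Notation wt := (weight g eps).

(* The projector onto ker (lie P) when P = V^* diag(d) V. *)
Definition zero_weight_proj (V : 'M[C]_N) (d : 'rV[C]_N) : 'M[C]_M :=
  (tau g eps V)^t* *m
  diag_mx (\row_m (\sum_k d 0 k * (wt m k)%:~R == 0)%:R) *m tau g eps V.

Lemma zero_weight_proj_adj V d : (zero_weight_proj V d)^t* = zero_weight_proj V d.
Proof.
rewrite /zero_weight_proj !trmx_mul !map_mxM /= trmxCK mulmxA; congr (_ *m _ *m _).
rewrite tr_diag_mx map_diag_mx; congr diag_mx; apply/rowP => m; rewrite !mxE.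
by rewrite rmorph_nat.
Qed.

(** The Casimir commutes with [tau g eps V], and the 0/1 diagonal depends only on the weight of its
    index. *)
Lemma zero_weight_proj_casimir V d : V \is unitarymx ->
  zero_weight_proj V d *m cas = cas *m zero_weight_proj V d.
Proof.
move=> Vu; have Vu' : V^t* \is unitarymx by rewrite trmxC_unitary.
rewrite /zero_weight_proj -mulmxA casimir_tauC// !mulmxA tau_adj -casimir_tauC//.
congr (_ *m _); rewrite -!mulmxA; congr (_ *m _).
apply/matrixP => m m'; rewrite mul_diag_mx mul_mx_diag !mxE mulrC.
have [->|/(casimir_weight g_bij) e] := eqVneq (cas m m') 0; first by rewrite !mul0r.
by do 4 f_equal; apply: eq_bigr => k _; rewrite e.
Qed.

Variables (A : finType) (a0 : A) (P V : A -> 'M[C]_N) (d : A -> 'rV[C]_N).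
Hypothesis V_unitary : forall a, V a \is unitarymx.
Hypothesis P_spectral : forall a, P a = (V a)^t* *m diag_mx (d a) *m V a.
Hypothesis d_sign : forall a k, d a 0 k = 1 \/ d a 0 k = -1.
Hypothesis P_complete : forall i j, \sum_a P a i j *: P a = N%:R *: E j i.
Hypothesis P_id : P a0 = 1%:M.
Hypothesis N_gt1 : (1 < N)%N.

Local Notation proj a := (zero_weight_proj (V a) (d a)).
Local Notation m_ a m := (\sum_k d a 0 k * (wt m k)%:~R).

Lemma lie_P a : L (P a) = (tau g eps (V a))^t* *m diag_mx (\row_m m_ a m) *m tau g eps (V a).
Proof. by rewrite P_spectral lie_conj// lie_diag. Qed.

Lemma m_real a m : (m_ a m)^* = m_ a m.
Proof.
rewrite rmorph_sum; apply: eq_bigr => k _; rewrite rmorphM rmorph_int.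
by case: (d_sign a k) => ->; rewrite ?rmorphN rmorph1.
Qed.

Lemma lie_P_adj a : (L (P a))^t* = L (P a).
Proof.
rewrite lie_P !trmx_mul !map_mxM /= trmxCK mulmxA; congr (_ *m _ *m _).
rewrite tr_diag_mx map_diag_mx; congr diag_mx; apply/rowP => m; rewrite !mxE.
exact: m_real.
Qed.

Lemma norm_m a m : `|m_ a m| <= (\sum_k `|wt m k|)%:~R.
Proof.
apply: le_trans (ler_norm_sum _ _ _) _; rewrite rmorph_sum; apply: ler_sum => k _ /=.
by rewrite normrM intr_norm; case: (d_sign a k) => ->; rewrite ?normrN normr1 mul1r.
Qed.

Lemma lie_id : L (1%:M : 'M[C]_N) = 0.
Proof.
rewrite -diag_const_mx lie_diag//; apply/matrixP => i j; rewrite !mxE.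
under eq_bigr do rewrite mxE mul1r.
by rewrite -rmorph_sum /= (sum_weight g eps_balanced) mul0rn.
Qed.

(** Expand the first factor in the E_ij: completeness collapses the second factors to N [L (E j i)].
    The identity acts by 0 on balanced tensors, so leaving it out changes nothing. *)
Lemma sum_lie_P_sq : \sum_(a | a != a0) L (P a) *m L (P a) = N%:R *: cas.
Proof.
rewrite -[LHS]add0r -[X in X + _](mul0mx _ (L (P a0))) -{1}lie_id -{1}P_id.
rewrite -(bigD1 a0 (P := predT) (F := fun a => L (P a) *m L (P a)))//= /casimir.
transitivity (\sum_i \sum_j L (E i j) *m (\sum_a P a i j *: L (P a))).
  under [RHS]eq_bigr do under eq_bigr do rewrite mulmx_sumr.
  under [RHS]eq_bigr do rewrite exchange_big.
  rewrite exchange_big; apply: eq_bigr => a _.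
  have e : L (P a) = \sum_i \sum_j P a i j *: L (E i j).
    rewrite {1}(matrix_sum_delta (P a)) linear_sum; apply: eq_bigr => i _.
    by rewrite linear_sum; apply: eq_bigr => j _; rewrite linearZ.
  rewrite {1}e mulmx_suml; apply: eq_bigr => i _.
  by rewrite mulmx_suml; apply: eq_bigr => j _; rewrite -scalemxAl scalemxAr.
rewrite scaler_sumr; apply: eq_bigr => i _; rewrite scaler_sumr; apply: eq_bigr => j _.
rewrite scalemxAr; congr (_ *m _).
under eq_bigr do rewrite -linearZ.
by rewrite -linear_sum P_complete linearZ.
Qed.

(** In the eigenbasis of [L (P a)] the claim is coordinatewise: an eigenvalue m with |m| <= K
    satisfies K^2 [m = 0] + m^2 <= K^2. The rotated vector stays in the same Casimir eigenspace, so
    the bound K applies to its weights. *)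
Lemma dotc_proj_le a (K : C) (c : C) (z : 'cV[C]_M) :
  0 <= K -> cas *m z = c *: z ->
  (forall (y : 'cV[C]_M) m, cas *m y = c *: y -> y m 0 != 0 -> (\sum_k `|wt m k|)%:~R <= K) ->
  0 <= dotc z (proj a *m z) /\
  K ^+ 2 * dotc z (proj a *m z) + sqnorm (L (P a) *m z) <= K ^+ 2 * sqnorm z.
Proof.
move=> K0 casz Kbound; pose w := tau g eps (V a) *m z.
have Tu := tau_unitary g_bij eps (V_unitary a).
have casw : cas *m w = c *: w.
  by rewrite mulmxA -casimir_tauC// -mulmxA casz scalemxAr.
have -> : dotc z (proj a *m z) = \sum_m (m_ a m == 0)%:R * `|w m 0| ^+ 2.
  rewrite /zero_weight_proj -!mulmxA dotc_mulmx trmxCK -/w.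
  by rewrite dotc_diag; apply: eq_bigr => m _; rewrite mxE.
have -> : sqnorm (L (P a) *m z) = \sum_m `|m_ a m| ^+ 2 * `|w m 0| ^+ 2.
  rewrite lie_P -!mulmxA sqnorm_unitary ?trmxC_unitary// -/w.
  by rewrite sqnorm_diag; apply: eq_bigr => m _; rewrite mxE.
have -> : sqnorm z = \sum_m `|w m 0| ^+ 2 by rewrite -(sqnorm_unitary z Tu).
split; first by apply: sumr_ge0 => m _; rewrite mulr_ge0 ?ler0n ?exprn_ge0.
rewrite !mulr_sumr -big_split /=; apply: ler_sum => m _.
have [->|/(Kbound _ _ casw) wm] := eqVneq (w m 0) 0.
  by rewrite normr0 expr0n !mulr0 addr0.
rewrite mulrA -mulrDl ler_wpM2r ?exprn_ge0//.
have [->|_] := eqVneq (m_ a m) 0; first by rewrite normr0 expr0n mulr1 addr0.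
rewrite mulr0 add0r lerXn2r ?nnegrE//; exact: le_trans (norm_m _ _) wm.
Qed.

Variable H : 'M[C]_M.
Hypothesis H_casimir : H *m cas = cas *m H.
Hypothesis H_lie : forall a, a != a0 -> L (P a) *m H = 0.
Hypothesis H_fixed : forall x : 'cV[C]_M,
  (forall i j, L (E i j) *m x = 0) -> H *m x = x.
Hypothesis card_A : #|A| = (N ^ 2)%N.

Local Notation n1 := ((N ^ 2 - 1)%:R : C).
Local Notation avg := (n1^-1 *: \sum_(a | a != a0) proj a).

(** The hypothesis on [mu] is 1 - N [spread h] / (2 (N^2 - 1) K^2) <= mu, cleared of denominators;
    the factor 2 compensates for [spread] being twice the eigenvalue. *)
Theorem sqnorm_gap (mu : C) : 0 < mu ->
  (forall h : 'I_N -> int, \sum_k h k = 0 -> \sum_k `|h k| <= #|S|%:R ->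
     0 < \sum_k `|h k| ->
     2 * n1 * (\sum_k `|h k|)%:~R ^+ 2 - N%:R * (spread h)%:~R <=
     mu * (2 * n1 * (\sum_k `|h k|)%:~R ^+ 2)) ->
  forall x, sqnorm ((avg - H) *m x) <= mu ^+ 2 * sqnorm x.
Proof.
move=> mu0 mu_bound.
have n1_gt0 : 0 < n1 by rewrite ltr0n subn_gt0 -{1}(exp1n 2) ltn_exp2r.
have card_A1 : #|[pred a | a != a0]| = (N ^ 2 - 1)%N.
  by have := cardC1 a0; rewrite card_A subn1 => <-; apply: eq_card.
have avg_adj : avg^t* = avg.
  rewrite linearZ /= map_mxZ fmorphV rmorph_nat; congr (_ *: _).
  rewrite !raddf_sum; apply: eq_bigr => a _; exact: zero_weight_proj_adj.
have avg_cas : avg *m cas = cas *m avg.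
  rewrite -scalemxAl -scalemxAr mulmx_suml mulmx_sumr; congr (_ *: _).
  by apply: eq_bigr => a _; rewrite zero_weight_proj_casimir.
have casH : cas *m H = 0.
  apply/eqP; have := scaler_eq0 N%:R (cas *m H); rewrite scalemxAl -sum_lie_P_sq.
  rewrite mulmx_suml big1 ?eqxx ?pnatr_eq0; last first.
    by move=> a aa; rewrite -mulmxA H_lie// mulmx0.
  by rewrite gtn_eqF 1?ltnW// => <-.
apply: (sqnorm_le_eigenspaces (casimir_adj C g eps)).
  by rewrite mulmxBl avg_cas H_casimir mulmxBr.
move=> c x casx; have [c0|c_neq0] := eqVneq c 0.
  have Ex i j : L (E i j) *m x = 0.
    (* The form of the Casimir at x is a sum of squared norms, so its vanishing kills every term. *)
    have : \sum_i \sum_j sqnorm (L (E j i) *m x) = 0.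
      transitivity (dotc x (cas *m x)); last by rewrite casx c0 scale0r /dotc mulmx0 mxE.
      rewrite /casimir mulmx_suml dotc_sumr; apply: eq_bigr => k _.
      rewrite mulmx_suml dotc_sumr; apply: eq_bigr => l _.
      by rewrite sqnorm_mulmx lie_adj delta_mx_adj mulmxA.
    move/psumr_eq0P => /(_ (fun k _ => sumr_ge0 _ (fun l _ => sqnorm_ge0 _)))/(_ j isT).
    move/psumr_eq0P => /(_ (fun l _ => sqnorm_ge0 _))/(_ i isT)/eqP.
    by rewrite sqnorm_eq0 => /eqP.
  have projx a : proj a *m x = x.
    have Tu := tau_unitary g_bij eps (V_unitary a).
    rewrite /zero_weight_proj -!mulmxA; set w := tau g eps (V a) *m x.
    have w_m : diag_mx (\row_m m_ a m) *m w = 0.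
      transitivity (tau g eps (V a) *m (L (P a) *m x)).
        by rewrite lie_P -!mulmxA -/w mulmxA (unitarymxP Tu) mul1mx.
      by rewrite lie_eq0// mulmx0.
    have diag_w : diag_mx (\row_m (m_ a m == 0)%:R) *m w = w.
      apply/colP => m; rewrite mul_diag_mx mxE [X in X * _]mxE.
      move/colP/(_ m): w_m; rewrite mul_diag_mx mxE [X in X * _]mxE [in RHS]mxE.
      move/eqP; rewrite mulf_eq0 => /orP[->|/eqP ->]; last by rewrite mulr0.
      by rewrite mul1r.
    by rewrite diag_w /w mulmxA unitarymxK// mul1mx.
  rewrite mulmxBl H_fixed// -scalemxAl mulmx_suml (eq_bigr _ (fun a _ => projx a)).
  have -> : \sum_(a | a != a0) x = n1 *: x by rewrite sumr_const card_A1 scaler_nat.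
  rewrite scalerA mulVf ?scale1r ?subrr ?lt0r_neq0//.
  by rewrite sqnorm0 mulr_ge0 ?exprn_ge0 ?sqnorm_ge0 ?ltW.
(* c H x = H cas x = cas H x = 0 with c nonzero. *)
have Hx : H *m x = 0.
  apply/eqP; have := scaler_eq0 c (H *m x); rewrite scalemxAr -casx mulmxA H_casimir.
  by rewrite casH mul0mx eqxx (negbTE c_neq0) /= => <-.
rewrite mulmxBl Hx subr0.
apply: (sqnorm_le_form mu0 avg_adj avg_cas _ casx) => z casz.
have [->|z0] := eqVneq z 0; first by rewrite mulmx0 {1}/dotc mulmx0 mxE lexx sqnorm0 mulr0 /dotc mulmx0 mxE lexx.
have [h [h0 hS hc hbound]] := dominant_weight g_bij eps_balanced z0 casz.
set K := \sum_k `|h k| in hS hbound; pose KC : C := K%:~R.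
have K_ge0 : 0 <= K by apply: sumr_ge0.
(* K = 0 would force h = 0 and hence the eigenvalue 0, which is excluded here. *)
have K_gt0 : 0 < K.
  rewrite lt0r K_ge0 andbT; apply: contra_neq c_neq0 => K0.
  have hk k : h k = 0.
    apply/eqP; rewrite -normr_eq0; apply/eqP; move: K0 => /psumr_eq0P; exact.
  apply/eqP; have : 2 * c == 0.
    rewrite hc /spread !big1 ?mulr0 ?addr0// => i _; rewrite ?hk ?expr0n//.
    by apply: big1 => j _; rewrite !hk subrr normr0.
  by rewrite mulf_eq0 pnatr_eq0.
have KC_gt0 : 0 < KC by rewrite ltr0z.
have bnd a : 0 <= dotc z (proj a *m z) /\
    KC ^+ 2 * dotc z (proj a *m z) + sqnorm (L (P a) *m z) <= KC ^+ 2 * sqnorm z.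
  apply: dotc_proj_le casz _; first exact: ltW.
  by move=> y m casy ym; rewrite ler_int; apply: hbound ym.
have -> : dotc z (avg *m z) = n1^-1 * \sum_(a | a != a0) dotc z (proj a *m z).
  by rewrite -scalemxAl dotcZr mulmx_suml dotc_sumr.
have sum_ge0 : 0 <= \sum_(a | a != a0) dotc z (proj a *m z).
  by apply: sumr_ge0 => a _; case: (bnd a).
have n1V_ge0 : 0 <= n1^-1 by rewrite invr_ge0 ltW.
rewrite (mulr_ge0 n1V_ge0 sum_ge0) /=.
have sumL : 2 * \sum_(a | a != a0) sqnorm (L (P a) *m z) = N%:R * (spread h)%:~R * sqnorm z.
  transitivity (2 * dotc z ((N%:R *: cas) *m z)).
    rewrite -sum_lie_P_sq mulmx_suml dotc_sumr; congr (_ * _); apply: eq_bigr => a _.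
    by rewrite sqnorm_mulmx lie_P_adj mulmxA.
  by rewrite -scalemxAl casz scalerA dotcZr dotc_self -hc; ring.
(* Sum the bounds [bnd] over the N^2 - 1 elements other than a0; the squares add up to the Casimir
   eigenvalue by [sumL]. *)
have main : 2 * KC ^+ 2 * \sum_(a | a != a0) dotc z (proj a *m z) <=
   (2 * n1 * KC ^+ 2 - N%:R * (spread h)%:~R) * sqnorm z.
  move: (KC ^+ 2) bnd => K2 bnd.
  rewrite mulrBl -sumL lerBrDr -!mulrA -mulrDr ler_pM2l ?ltr0n//.
  rewrite [X in X + _]mulr_sumr -big_split /=.
  have -> : n1 * (K2 * sqnorm z) = \sum_(a | a != a0) K2 * sqnorm z.
    by rewrite sumr_const card_A1 mulr_natl.
  by apply: ler_sum => a _; case: (bnd a).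
rewrite ler_pdivrMl// -(@ler_pM2l _ (2 * KC ^+ 2)) ?mulr_gt0 ?exprn_gt0//.
apply: (le_trans main); apply: (le_trans (ler_wpM2r (sqnorm_ge0 z) (mu_bound h h0 hS K_gt0))).
by rewrite le_eqVlt; apply/orP; left; apply/eqP; rewrite -/K -/KC; ring.
Qed.

End MainBound.

(** * Kronecker powers and Pauli strings *)

Lemma kron_idx_inj m n : injective (@kron_idx m n).
Proof. by move=> i j /enum_val_inj/cast_ord_inj. Qed.

(** Letters of an index along nested splittings by [kron_idx], letter 0 belonging to the outermost
    factor; this mirrors the recursion of [kronpow] and [pauli_string]. *)
Fixpoint digits N t : 'I_(N ^ t) -> {ffun 'I_t -> 'I_N} :=
  match t with
  | 0 => fun _ => ffun0 (card_ord 0)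
  | t'.+1 => fun k => let p := kron_idx (cast_ord (expnS N t') k) in
      [ffun i => if unlift ord0 i is Some j then digits p.2 j else p.1]
  end.

Lemma digits_inj N t : injective (@digits N t).
Proof.
elim: t => [|t IH] k l /=.
  by move=> _; apply: val_inj; case: k => -[|k]//; case: l => -[|l].
move=> /ffunP e; apply: (@cast_ord_inj _ _ (expnS N t)); apply: kron_idx_inj.
apply: injective_projections; first by have := e ord0; rewrite !ffunE unlift_none.
by apply: IH; apply/ffunP => s; have := e (lift ord0 s); rewrite !ffunE liftK.
Qed.

Lemma digits_bij N t : bijective (@digits N t).
Proof.
by apply: (inj_card_bij (@digits_inj N t)); rewrite card_ffun !card_ord.
Qed.

(** Left summands are the slots of U and right summands those of conj(U), so [is_inl] serves as
    [eps]. *)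
Definition moment_index N t (k : 'I_(N ^ t * N ^ t)) : {ffun 'I_t + 'I_t -> 'I_N} :=
  [ffun s => match s with
    | inl a => digits (kron_idx k).1 a
    | inr b => digits (kron_idx k).2 b end].

Lemma moment_index_bij N t : bijective (@moment_index N t).
Proof.
apply: inj_card_bij; last by rewrite card_ffun card_sum !card_ord expnD.
move=> k l /ffunP e; apply: kron_idx_inj; apply: injective_projections;
  apply: digits_inj; apply/ffunP => s.
- by have := e (inl s); rewrite !ffunE.
- by have := e (inr s); rewrite !ffunE.
Qed.

Section Kron.
Variable R : realType.
Local Notation C := R[i].

Lemma castmx_expnSE N t (A : 'M[C]_(N * N ^ t)) i j :
  castmx (esym (expnS N t), esym (expnS N t)) A i j =
  A (cast_ord (expnS N t) i) (cast_ord (expnS N t) j).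
Proof. by rewrite castmxE /= esymK. Qed.

Lemma kronpowE N t (A : 'M[C]_N) i j :
  kronpow A t i j = \prod_s A (digits i s) (digits j s).
Proof.
elim: t i j => [|t IH] i j /=.
  by rewrite castmxE big_ord0 !ord1 mxE eqxx.
rewrite castmx_expnSE mxE big_ord_recl !ffunE unlift_none IH; congr (_ * _).
by apply: eq_bigr => s _; rewrite !ffunE liftK.
Qed.

Lemma pauli_stringE n (s : 'I_n -> 'I_4) :
  pauli_string R s = tens (@digits 2 n) (fun r => pauli1 R (s r)).
Proof.
apply/matrixP => i j; rewrite mxE; elim: n s i j => [|n IH] s i j /=.
  by rewrite castmxE big_ord0 !ord1 mxE eqxx.
rewrite castmx_expnSE mxE big_ord_recl !ffunE unlift_none IH; congr (_ * _).
by apply: eq_bigr => r _; rewrite !ffunE liftK.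
Qed.

Lemma kron_tau N t (U : 'M[C]_N) :
  kron (kronpow U t) (kronpow (cmx_conj U) t) =
  tau (@moment_index N t) (@is_inl 'I_t 'I_t) U.
Proof.
apply/matrixP => i j; rewrite !mxE !kronpowE big_sumType /=; congr (_ * _).
  by apply: eq_bigr => s _; rewrite !ffunE.
by apply: eq_bigr => s _; rewrite !ffunE !mxE.
Qed.

Lemma cmx_adjE m n (A : 'M[C]_(m, n)) : cmx_adj A = A^t*.
Proof. by apply/matrixP => i j; rewrite !mxE. Qed.

Lemma moment_balanced t :
  \sum_(s : 'I_t + 'I_t) (if is_inl s then 1 else -1) = 0 :> int.
Proof.
by rewrite big_sumType /= !sumr_const card_ord mulNrn addrN.
Qed.

End Kron.

(** * Pauli matrices and their completeness relation *)

Section Pauli.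
Variable R : realType.
Local Notation C := R[i].

Lemma pauli1_adj a : (pauli1 R a)^t* = pauli1 R a.
Proof.
apply/matrixP => i j; rewrite !mxE.
by case: a => -[|[|[|[|a]]]] // ?; case: i => -[|[|i]] // ?; case: j => -[|[|j]] // ? /=;
  simpc.
Qed.

Lemma pauli1_sq a : pauli1 R a *m pauli1 R a = 1%:M.
Proof.
apply/matrixP => i j; rewrite !mxE !big_ord_recl big_ord0 !mxE.
by case: a => -[|[|[|[|a]]]] // ?; case: i => -[|[|i]] // ?; case: j => -[|[|j]] // ? /=;
  simpc.
Qed.

Lemma pauli1_trace a : a != ord0 -> \tr (pauli1 R a) = 0.
Proof.
rewrite /mxtrace !big_ord_recl big_ord0 !mxE.
by case: a => -[|[|[|[|a]]]] // ? ? /=; simpc.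
Qed.

(** The sum of sigma_a (x) sigma_a is twice the swap; the sixteen entries are checked one by one. *)
Lemma pauli1_complete i j k l : \sum_a pauli1 R a i j * pauli1 R a k l =
  2 * (i == l)%:R * (j == k)%:R.
Proof.
rewrite !big_ord_recl big_ord0 !mxE /=.
case: i => -[|[|i]] // ?; case: j => -[|[|j]] // ?;
case: k => -[|[|k]] // ?; case: l => -[|[|l]] // ? /=; simpc;
apply/eqP; rewrite eq_complex /=; apply/andP; split; apply/eqP; ring.
Qed.
End Pauli.

Lemma tens_trace (C : numClosedFieldType) N M (S : finType) (g : 'I_M -> {ffun S -> 'I_N})
  (B : S -> 'M[C]_N) : bijective g -> \tr (tens g B) = \prod_s \tr (B s).
Proof.
move=> g_bij; rewrite /mxtrace (bigA_distr_bigA (fun s x => B s x x)) [RHS](reindex g) /=.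
  by apply: eq_bigr => i _; rewrite mxE.
exact: onW_bij.
Qed.

Section PauliString.
Variables (R : realType) (n : nat).
Local Notation C := R[i].
Implicit Type s : {ffun 'I_n -> 'I_4}.
Local Notation P s := (pauli_string R s).

Lemma pauli_string_adj s : (P s)^t* = P s.
Proof.
rewrite pauli_stringE tens_adj; apply: eq_tens => r; exact: pauli1_adj.
Qed.

Lemma pauli_string_sq s : P s *m P s = 1%:M.
Proof.
rewrite pauli_stringE tens_mul; last exact: digits_bij.
rewrite -[RHS](tens1 _ (@digits_bij 2 n)).
by apply: eq_tens => r; exact: pauli1_sq.
Qed.

Lemma pauli_string_id : P ([ffun => ord0] : {ffun 'I_n -> 'I_4}) = 1%:M.
Proof.
rewrite pauli_stringE -[RHS](tens1 _ (@digits_bij 2 n)); apply: eq_tens => r.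
by rewrite ffunE; apply/matrixP => i j; rewrite !mxE /=; case: eqP.
Qed.

Lemma pauli_string_trace s : s != [ffun => ord0] -> \tr (P s) = 0.
Proof.
move=> s0; have [r sr] : exists r, s r != ord0.
  apply/existsP; apply: contraR s0; rewrite negb_exists => /forallP e.
  by apply/eqP/ffunP => r; rewrite ffunE; apply/eqP; have := e r; rewrite negbK.
rewrite pauli_stringE tens_trace; last exact: digits_bij.
by rewrite (bigD1 r)//= pauli1_trace// mul0r.
Qed.

(** The sum over strings of a product over sites factors into the single-site relation at each site;
    the digit equalities combine into equality of indices because [digits] is injective. *)
Lemma pauli_string_complete i j :
  \sum_(s : {ffun 'I_n -> 'I_4}) P s i j *: P s = (2 ^ n)%:R *: delta_mx j i.
Proof.
apply/matrixP => k l; rewrite summxE !mxE.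
transitivity (\sum_(s : {ffun 'I_n -> 'I_4}) \prod_r (pauli1 R (s r) (digits i r) (digits j r) *
    pauli1 R (s r) (digits k r) (digits l r))).
  by apply: eq_bigr => s _; rewrite mxE !pauli_stringE !mxE -big_split.
rewrite -(bigA_distr_bigA (fun r a => pauli1 R a (digits i r) (digits j r) *
    pauli1 R a (digits k r) (digits l r))) /=.
under eq_bigr do rewrite pauli1_complete.
rewrite !big_split /= prodr_const card_ord natrX -mulrA; congr (_ * _).
have prod_eq (a b : 'I_(2 ^ n)) :
    \prod_r (digits a r == digits b r)%:R = (a == b)%:R :> C.
  have [->|ab] := eqVneq a b; first by rewrite big1// => r _; rewrite eqxx.
  have [r dr] : exists r, digits a r != digits b r.
    apply/existsP; apply: contraR ab; rewrite negb_exists => /forallP e.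
    apply/eqP/(@digits_inj 2 n)/ffunP => r.
    by apply/eqP; have := e r; rewrite negbK.
  by rewrite (bigD1 r)//= (negbTE dr) mul0r.
by rewrite !prod_eq [i == l]eq_sym [j == k]eq_sym mulrC; case: (k == j); case: (l == i);
  rewrite ?mulr1 ?mulr0.
Qed.

End PauliString.

(** * Rotations generated by an involution *)

Section Rotation.
Variable R : realType.
Local Notation C := R[i].

Definition expi (x : R) : C := (cos x +i* sin x)%C.

Lemma expi0 : expi 0 = 1.
Proof. by rewrite /expi cos0 sin0. Qed.

Lemma expiD x y : expi (x + y) = expi x * expi y.
Proof. by rewrite /expi cosD sinD; simpc; congr (_ +i* _)%C; rewrite addrC. Qed.

Lemma expi_neq0 x : expi x != 0.
Proof.
apply/eqP => e; have := expiD x (- x).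
by rewrite subrr expi0 e mul0r; apply/eqP; rewrite oner_eq0.
Qed.

Lemma norm_expi x : `|expi x| = 1.
Proof. by rewrite normc_def /= cos2Dsin2 sqrtr1. Qed.

Lemma expi_expn x m : (expi x ^ m)%R = expi (m%:~R * x).
Proof.
have nat_case k : (expi x ^+ k)%R = expi (k%:R * x).
  elim: k => [|k IH]; first by rewrite expr0 mul0r expi0.
  by rewrite exprS IH -expiD mulrS mulrDl mul1r.
case: m => k; first by rewrite -exprnP nat_case.
rewrite NegzE -exprnN nat_case; apply: (mulfI (expi_neq0 (k.+1%:R * x))).
rewrite divff ?expi_neq0// -expiD rmorphN mulNr /= -pmulrn subrr expi0 //.
Qed.

Variable N : nat.

(** Euler form of exp(i x P) for an involution P. *)
Definition rotation (P : 'M[C]_N) (x : R) : 'M[C]_N :=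
  (cos x)%:C%C *: 1%:M + ('i * (sin x)%:C)%C *: P.

Variables (V P : 'M[C]_N) (e : 'I_N -> int).
Hypothesis V_unitary : V \is unitarymx.
Hypothesis P_spectral : P = V^t* *m diag_mx (\row_k (e k)%:~R) *m V.
Hypothesis e_sign : forall k, e k = 1 \/ e k = -1.

Lemma rotation_spectral x :
  rotation P x = V^t* *m diag_mx (\row_k (expi x ^ e k)%R) *m V.
Proof.
have -> : diag_mx (\row_k (expi x ^ e k)%R) =
    (cos x)%:C%C *: 1%:M + ('i * (sin x)%:C)%C *: diag_mx (\row_k (e k)%:~R) :> 'M[C]_N.
  rewrite scale_scalar_mx mulr1 -diag_const_mx -linearZ -linearD /=; congr diag_mx.
  apply/rowP => k; rewrite !mxE expi_expn /expi.
  by case: (e_sign k) => ->; rewrite ?mul1r ?mulN1r ?cosN ?sinN; simpc.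
rewrite mulmxDr mulmxDl -!scalemxAr -!scalemxAl mulmx1 unitarymxK// /rotation.
by rewrite P_spectral.
Qed.

Lemma rotation_unitary x : rotation P x \is unitarymx.
Proof.
rewrite rotation_spectral; apply: unitarymx_conj_diag => // k.
by rewrite mxE expi_expn norm_expi.
Qed.

(** The determinant is [expi x] to the power tr P = 0; this puts the rotations in SU(N), where Haar
    invariance is available. *)
Lemma rotation_det x : \tr P = 0 -> \det (rotation P x) = 1.
Proof.
move=> trP; have se : \sum_k e k = 0.
  suff : (\sum_k e k)%:~R = \tr P by rewrite trP => /eqP; rewrite intr_eq0 => /eqP.
  rewrite P_spectral mxtrace_mulC mulmxA (unitarymxP V_unitary) mul1mx mxtrace_diag.
  by rewrite rmorph_sum; apply: eq_bigr => k _; rewrite mxE.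
rewrite rotation_spectral !det_mulmx mulrC mulrA -det_mulmx (unitarymxP V_unitary).
rewrite det1 mul1r det_diag.
under eq_bigr do rewrite mxE.
rewrite -(big_morph (fun z => (expi x ^ z)%R) (fun a b => expfzDr a b (expi_neq0 x)) (expr0z _)).
by rewrite se expr0z.
Qed.

Variables (M : nat) (S : finType) (g : 'I_M -> {ffun S -> 'I_N}) (eps : S -> bool).
Hypothesis g_bij : bijective g.
Hypothesis eps_balanced : \sum_s (if eps s then 1 else -1) = 0 :> int.

(* Since the weights sum to 0, sum_k e_k h_k = sum_k (e_k - 1) h_k is even. *)
Definition half_weight m : int := \sum_k (if e k == 1 then 0 else - weight g eps m k).

Lemma half_weightE m : \sum_k e k * weight g eps m k = half_weight m * 2.
Proof.
transitivity (\sum_k (e k * weight g eps m k - weight g eps m k)).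
  by rewrite sumrB (sum_weight g eps_balanced) subr0.
rewrite /half_weight mulr_suml.
apply: eq_bigr => k _; case: (e_sign k) => -> /=; rewrite ?mul1r ?subrr ?mul0r//.
by rewrite mulN1r; ring.
Qed.

(** The evenness of the eigenvalue absorbs the halved angle, so the diagonal consists of characters
    of x with integer frequencies. *)
Lemma tau_rotation x : tau g eps (rotation P (x / 2)) =
  (tau g eps V)^t* *m diag_mx (\row_m expi ((half_weight m)%:~R * x)) *m tau g eps V.
Proof.
rewrite rotation_spectral tau_conj_diag//; last first.
  by move=> k; rewrite mxE expi_expn norm_expi.
congr (_ *m diag_mx _ *m _); apply/rowP => m; rewrite !mxE.
transitivity (\prod_k (expi (x / 2) ^ (e k * weight g eps m k))%R).
  by apply: eq_bigr => k _; rewrite mxE exprz_exp.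
rewrite -(big_morph (fun z => (expi (x / 2) ^ z)%R)
  (fun a b => expfzDr a b (expi_neq0 (x / 2))) (expr0z _)).
by rewrite half_weightE expi_expn intrM -mulrA [2%:~R * _]mulrC divfK ?pnatr_eq0.
Qed.

Lemma zero_weight_projE :
  zero_weight_proj g eps V (\row_k (e k)%:~R) =
  (tau g eps V)^t* *m diag_mx (\row_m (half_weight m == 0)%:R) *m tau g eps V.
Proof.
congr (_ *m diag_mx _ *m _); apply/rowP => m; rewrite !mxE.
under eq_bigr do rewrite mxE -intrM.
by rewrite -rmorph_sum /= half_weightE intr_eq0 mulf_eq0 orbF.
Qed.

End Rotation.

(** * Rotations and their angular average *)

Local Open Scope classical_set_scope.

Section Exponential.
Variable R : realType.
Local Notation C := R[i].

Lemma cvg_real_complex (u : nat -> R) (l : R) :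
  u @ \oo --> l -> (fun k => (u k)%:C%C : C) @ \oo --> (l%:C%C : C).
Proof.
move=> /cvgrPdist_lt ul; apply/cvgrPdist_lt => -[e ei]; rewrite ltcE /= => /andP[/eqP ei0 e0].
near=> k; rewrite -rmorphB normc_def /= expr0n addr0 sqrtr_sqr ltcE /= ei0 eqxx /=.
by near: k; apply: ul.
Unshelve. all: by end_near. Qed.

Lemma imaginary_expr k :
  ('i%C : C) ^+ k = if odd k then 'i%C * (-1) ^+ k.-1./2 else (-1) ^+ k./2.
Proof.
elim/ltn_ind: k => -[|[|k]] IH //; first by rewrite expr1 mulr1.
rewrite 2!exprS mulrA -expr2 sqr_i IH// oddS oddS negbK.
case: ifP => ok; last by rewrite -exprS.
by case: k ok {IH} => // k _; rewrite mulrCA -exprS.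
Qed.

(** P^2 = 1 separates the even powers, which carry the cosine series, from the odd ones, which carry
    the sine series; the identity already holds for partial sums. *)
Lemma expmx_rotation N (P : 'M[C]_N) (x : R) :
  P *m P = 1%:M -> expmx (('i * x%:C)%C *: P) = rotation P x.
Proof.
move=> PP; rewrite /expmx.
have pow k : (('i * x%:C)%C *: P) ^+ k =
    ('i * x%:C)%C ^+ k *: (if odd k then P else 1%:M).
  elim: k => [|k IH]; first by rewrite !expr0 scale1r.
  rewrite !exprS IH -[LHS]/(_ *m _) -scalemxAl -scalemxAr scalerA; congr (_ *: _).
  by rewrite /=; case: (odd k); rewrite /= ?PP ?mulmx1.
have -> : series (fun k : nat => (k`!%:R : C)^-1 *: (('i * x%:C)%C *: P) ^+ k) =
  (fun k => (series (cos_coeff x) k)%:C%C *: 1%:M +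
            ('i%C * (series (sin_coeff x) k)%:C%C) *: P).
  apply/funext => k; rewrite /series /= !rmorph_sum mulr_sumr !scaler_suml -big_split /=.
  apply: eq_bigr => j _; rewrite pow /cos_coeff /sin_coeff /= exprMn imaginary_expr.
  rewrite scalerA; case: (odd j).
    rewrite !mul0r !scale0r add0r; congr (_ *: _).
    rewrite mul1r !rmorphM !rmorphXn rmorphN1 fmorphV rmorph_nat.
    rewrite mulrC -!mulrA; congr (_ * _); rewrite !mulrA; congr (_ * _).
  rewrite !mul0r !mulr0 scale0r addr0; congr (_ *: _).
  rewrite mul1r -exprnP !rmorphM !rmorphXn rmorphN1 fmorphV rmorph_nat.
  by rewrite mulrC.
apply: (cvg_lim (@norm_hausdorff _ _)); apply: cvgD; apply: cvgZr_tmp.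
  apply: cvg_real_complex; rewrite unlock; exact: is_cvg_series_cos_coeff.
apply: cvgMl_tmp; apply: cvg_real_complex; rewrite unlock; exact: is_cvg_series_sin_coeff.
Qed.

End Exponential.

(** * Integrals of complex-valued functions *)

Section ComplexIntegral.
Context d (T : measurableType d) (R : realType) (mu : {measure set T -> \bar R}).
Variable D : set T.
Hypothesis mD : measurable D.
Local Notation C := R[i].
Implicit Types f : T -> C.

Definition cintegrable f :=
  mu.-integrable D (EFin \o (fun x => complex.Re (f x))) /\
  mu.-integrable D (EFin \o (fun x => complex.Im (f x))).

(** Componentwise, in the shape of the entries of [theta_avg] and [mx_expect]. *)
Definition cintegral f : C :=
  ((\int[mu]_(x in D) complex.Re (f x)) +i* (\int[mu]_(x in D) complex.Im (f x)))%C.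

Lemma eq_cintegral f g : {in D, f =1 g} -> cintegral f = cintegral g.
Proof.
move=> fg; congr (_ +i* _)%C; apply: eq_Rintegral => x xD; by rewrite fg.
Qed.

Lemma cintegrableD f g : cintegrable f -> cintegrable g ->
  cintegrable (fun x => f x + g x) /\
  cintegral (fun x => f x + g x) = cintegral f + cintegral g.
Proof.
move=> [fr fi] [gr gi].
have E x : complex.Re (f x + g x) = complex.Re (f x) + complex.Re (g x).
  by case: (f x) (g x) => ? ? [].
have E' x : complex.Im (f x + g x) = complex.Im (f x) + complex.Im (g x).
  by case: (f x) (g x) => ? ? [].
split; first split.
- under eq_fun do rewrite E; exact: (integrableD mD fr gr).
- under eq_fun do rewrite E'; exact: (integrableD mD fi gi).
rewrite /cintegral; under eq_Rintegral do rewrite E; rewrite RintegralD//.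
by under [in X in (_ +i* X)%C]eq_Rintegral do rewrite E'; rewrite RintegralD.
Qed.

Lemma cintegrableZ (a : C) f : cintegrable f ->
  cintegrable (fun x => a * f x) /\ cintegral (fun x => a * f x) = a * cintegral f.
Proof.
move=> [fr fi].
have E x : complex.Re (a * f x) =
    complex.Re a * complex.Re (f x) - complex.Im a * complex.Im (f x).
  by case: a (f x) => ? ? [].
have E' x : complex.Im (a * f x) =
    complex.Re a * complex.Im (f x) + complex.Im a * complex.Re (f x).
  by clear E; case: a (f x) => ? ? [].
have ir k := integrableZl mD k fr; have ii k := integrableZl mD k fi.
split; first split.
- by under eq_fun do rewrite E; apply: (integrableB mD (ir _) (ii _)).
- by under eq_fun do rewrite E'; apply: (integrableD mD (ii _) (ir _)).
rewrite /cintegral; under eq_Rintegral do rewrite E.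
rewrite RintegralB ?RintegralZl//; [|exact: ir|exact: ii].
under [in X in (_ +i* X)%C]eq_Rintegral do rewrite E'.
rewrite RintegralD ?RintegralZl//; [|exact: ii|exact: ir].
by clear E E'; case: a => a b; simpc.
Qed.

Lemma cintegrable_sum (I : finType) (f : I -> T -> C) :
  (forall i, cintegrable (f i)) ->
  cintegrable (fun x => \sum_i f i x) /\
  cintegral (fun x => \sum_i f i x) = \sum_i cintegral (f i).
Proof.
move=> intf; elim: (index_enum I) => [|i s [IH1 IH2]].
  under eq_fun do rewrite big_nil; rewrite big_nil; split.
    by split; rewrite /=; exact: integrable0.
  by rewrite /cintegral /= !Rintegral_cst// !mul0r.
have [H1 H2] := cintegrableD (intf i) IH1.
by under eq_fun do rewrite big_cons; rewrite big_cons H2 IH2.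
Qed.

End ComplexIntegral.

(** * Fourier averages over the angle *)

Section AngleAverage.
Variable R : realType.
Local Notation C := R[i].
Local Notation mu := (@lebesgue_measure R).

Lemma is_derive_scale (F : R -> R) (k x l : R) :
  is_derive x 1 F l -> is_derive x 1 (fun y => k * F y) (k * l).
Proof. by move=> h; exact: (is_deriveZ k h). Qed.

Lemma is_derive_sin_scale (k x : R) : is_derive x 1 (fun y => sin (k * y)) (k * cos (k * x)).
Proof.
have h := is_derive_scale k (is_derive_id x 1); rewrite mulr1 in h.
by have := is_derive1_comp (is_derive_sin (k * x)) h; rewrite mulrC.
Qed.

Lemma is_derive_cos_scale (k x : R) : is_derive x 1 (fun y => cos (k * y)) (- (k * sin (k * x))).
Proof.
have h := is_derive_scale k (is_derive_id x 1); rewrite mulr1 in h.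
by have := is_derive1_comp (is_derive_cos (k * x)) h; rewrite mulrC mulrN.
Qed.

Lemma integral_derivative (F f : R -> R) (a b : R) : a < b ->
  (forall x : R, is_derive x 1 F (f x)) -> continuous f ->
  \int[mu]_(x in `]a, b[) f x = F b - F a.
Proof.
move=> ab dF cf.
have cF : continuous F.
  by move=> x; apply: differentiable_continuous; apply/derivable1_diffP; exact: (@ex_derive _ _ _ _ _ _ _ (dF x)).
have int_f : mu.-integrable `[a, b] (EFin \o f).
  apply: continuous_compact_integrable; first exact: segment_compact.
  exact: continuous_subspaceT.
(* The endpoints are null sets; the fundamental theorem of calculus is applied on the closed
   interval. *)
rewrite Rintegral_itv_obnd_cbnd; last first.
  by apply: integrableS int_f => //; exact: subset_itv_oo_cc.
rewrite Rintegral_itv_bndo_bndc; last first.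
  by apply: integrableS int_f => //; exact: subset_itv_co_cc.
rewrite /Rintegral (@continuous_FTC2 _ f F)//.
- exact: continuous_subspaceT.
- split.
  + by move=> x _; exact: (@ex_derive _ _ _ _ _ _ _ (dF x)).
  + by apply: cvg_at_right_filter; exact: cF.
  + by apply: cvg_at_left_filter; exact: cF.
- by move=> x _; rewrite derive1E; exact: (@derive_val _ _ _ _ _ _ _ (dF x)).
Qed.

(** exp(i q pi) = (-1)^q is real. *)
Lemma sin_int_pi (q : int) : sin (q%:~R * pi) = 0 :> R.
Proof.
have : expi (q%:~R * pi) = (expi (pi : R) ^ q)%R by rewrite expi_expn.
have -> : expi (pi : R) = (-1)%:C%C by rewrite /expi cospi sinpi.
by rewrite -fmorphXz => -[].
Qed.

Lemma continuous_scale_comp (f : R -> R) (k : R) : continuous f -> continuous (fun x => f (k * x)).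
Proof.
move=> cf x; apply: (continuous_comp _ (cf _)).
exact: mulrl_continuous.
Qed.

Lemma integral_cos_int (q : int) :
  \int[mu]_(x in `]- pi, pi[) cos (q%:~R * x) = 2 * pi * (q == 0)%:R :> R.
Proof.
have pp : - pi < pi :> R by rewrite gtrN// pi_gt0.
have cc k : continuous (fun x : R => cos (k * x)).
  by apply: continuous_scale_comp; exact: continuous_cos.
have [->|q0] := eqVneq q 0.
  have dF (x : R) : is_derive x 1 (fun y : R => y) (cos (0%:~R * x)).
    by rewrite mul0r cos0; exact: is_derive_id.
  by rewrite (integral_derivative pp dF (cc _)) opprK mulr1 mulr_natl mulr2n.
have q0' : q%:~R != 0 :> R by rewrite intr_eq0.
have dF (x : R) : is_derive x 1 (fun y => q%:~R^-1 * sin (q%:~R * y)) (cos (q%:~R * x)).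
  by have := is_derive_scale q%:~R^-1 (is_derive_sin_scale q%:~R x); rewrite mulKf.
rewrite (integral_derivative pp dF (cc _)).
by rewrite mulrN sinN sin_int_pi oppr0 !mulr0 subrr.
Qed.

Lemma integral_sin_int (q : int) :
  \int[mu]_(x in `]- pi, pi[) sin (q%:~R * x) = 0 :> R.
Proof.
have pp : - pi < pi :> R by rewrite gtrN// pi_gt0.
have [->|q0] := eqVneq q 0.
  under eq_Rintegral do rewrite mul0r sin0.
  by rewrite Rintegral_cst// mul0r.
have q0' : q%:~R != 0 :> R by rewrite intr_eq0.
have dF (x : R) : is_derive x 1 (fun y => - q%:~R^-1 * cos (q%:~R * y)) (sin (q%:~R * x)).
  by have := is_derive_scale (- q%:~R^-1) (is_derive_cos_scale q%:~R x); rewrite mulrNN mulKf.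
have cs : continuous (fun x : R => sin (q%:~R * x)).
  by apply: continuous_scale_comp; exact: continuous_sin.
rewrite (integral_derivative pp dF cs).
by rewrite mulrN cosN subrr.
Qed.

Lemma cintegral_expi (q : int) :
  cintegrable mu `]- pi, pi[ (fun x => expi (q%:~R * x)) /\
  cintegral mu `]- pi, pi[ (fun x => expi (q%:~R * x)) = (2 * pi * (q == 0)%:R)%:C%C :> C.
Proof.
have int_f (f : R -> R) : continuous f ->
    mu.-integrable `]- pi, pi[ (EFin \o (fun x => f (q%:~R * x))).
  move=> cf; apply: (@integrableS _ _ _ mu `[- pi, pi]) => //.
    exact: subset_itv_oo_cc.
  apply: continuous_compact_integrable; first exact: segment_compact.
  by apply: continuous_subspaceT; exact: continuous_scale_comp.
split; last by rewrite /cintegral /= integral_cos_int integral_sin_int.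
by split; apply: int_f; [exact: continuous_cos|exact: continuous_sin].
Qed.

(** Over a full period the mean of exp(i q x) is 1 for q = 0 and 0 otherwise, and each entry is a
    finite linear combination of such characters. *)
Lemma theta_avg_diag M (A B : 'M[C]_M) (q : 'I_M -> int) :
  theta_avg (fun x => A *m diag_mx (\row_m expi ((q m)%:~R * x)) *m B) =
  A *m diag_mx (\row_m (q m == 0)%:R) *m B.
Proof.
apply/matrixP => i j; rewrite [LHS]mxE.
pose f m (x : R) : C := A i m * B m j * expi ((q m)%:~R * x).
have FE x : (A *m diag_mx (\row_m expi ((q m)%:~R * x)) *m B) i j = \sum_m f m x.
  rewrite mul_mx_diag mxE; apply: eq_bigr => m _; rewrite !mxE /f.
  by rewrite mulrAC.
have fZ m := @cintegrableZ _ _ R mu _ (measurable_itv _) (A i m * B m j) _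
  (cintegral_expi (q m)).1.
have [_ E] := @cintegrable_sum _ _ R mu _ (measurable_itv _) _ f (fun m => (fZ m).1).
transitivity (((2 * pi)^-1 : R)%:C%C * cintegral mu `]- pi, pi[ (fun x => \sum_m f m x)).
  rewrite /cintegral; simpc; congr (_ * _ +i* (_ * _))%C;
    by apply: eq_Rintegral => x _; rewrite FE.
rewrite E mulr_sumr mul_mx_diag mxE; apply: eq_bigr => m _.
have pi2 : 2 * pi != 0 :> R by rewrite mulf_neq0 ?pnatr_eq0 ?gt_eqF ?pi_gt0.
rewrite (fZ m).2 (cintegral_expi (q m)).2 mulrCA -rmorphM mulKf// rmorph_nat !mxE.
by rewrite mulrAC.
Qed.

End AngleAverage.

(** * Haar moments *)

Section ComplexContinuity.
Variable R : realType.
Local Notation C := R[i].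

Lemma norm_Re_Im_le1 (z : C) : `|z| <= 1 ->
  `|complex.Re z| <= 1 /\ `|complex.Im z| <= 1.
Proof.
case: z => a b; rewrite normc_def lecE /= => /andP[_ h].
have : a ^+ 2 + b ^+ 2 <= 1.
  by rewrite -(sqr_sqrtr (addr_ge0 (sqr_ge0 a) (sqr_ge0 b))) expr_le1 ?sqrtr_ge0.
move=> h2; split; rewrite -(@expr_le1 _ 2)// real_normK ?num_real//; apply: le_trans h2.
  by rewrite lerDl sqr_ge0.
by rewrite lerDr sqr_ge0.
Qed.

Lemma Re_continuous : continuous (@complex.Re R : C -> R).
Proof.
move=> z; have [_ h] := @cvgrPdist_lt _ R^o C (nbhs z) _ (@complex.Re R) (complex.Re z).
apply: h => e e0; have e0' : 0 < (e%:C%C : C) by rewrite ltcR.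
near=> w; rewrite -ltcR; apply: (@le_lt_trans _ _ `|z - w|).
  rewrite (_ : complex.Re z - _ = complex.Re (z - w)) ?normc_ge_Re//.
  by case: (z) (w) => ? ? [].
by near: w; exact: (nbhsx_ballx z _ e0').
Unshelve. all: by end_near. Qed.

Lemma Im_continuous : continuous (@complex.Im R : C -> R).
Proof.
move=> z; have [_ h] := @cvgrPdist_lt _ R^o C (nbhs z) _ (@complex.Im R) (complex.Im z).
apply: h => e e0; have e0' : 0 < (e%:C%C : C) by rewrite ltcR.
near=> w; rewrite -ltcR; apply: (@le_lt_trans _ _ `|z - w|).
  (* Im z = Re (- i z), and multiplication by - i preserves the modulus. *)
  rewrite (_ : complex.Im z - _ = complex.Re (- 'i * (z - w))%C).
    apply: le_trans (normc_ge_Re _) _.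
    have i1 : `|- 'i%C : C| = 1.
      by rewrite normrN normc_def /= expr0n expr1n add0r sqrtr1.
    by rewrite normrM i1 mul1r.
  by case: (z) (w) => ? ? [] ? ?; simpc.
by near: w; exact: (nbhsx_ballx z _ e0').
Unshelve. all: by end_near. Qed.

Lemma conjc_continuous : continuous (@conjc R : C -> C).
Proof.
move=> z; have [_ h] := @cvgrPdist_lt _ C^o C (nbhs z) _ (@conjc R) (conjc z).
apply: h => e e0; near=> w; rewrite -rmorphB normcJ.
by near: w; exact: (nbhsx_ballx z _ e0).
Unshelve. all: by end_near. Qed.

Lemma prod_continuous (T : topologicalType) (I : finType) (F : I -> T -> C) :
  (forall i, continuous (F i)) -> continuous (fun x => \prod_i F i x).
Proof.
move=> cF; elim: (index_enum I) => [|i s IH].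
  by under eq_fun do rewrite big_nil; exact: cst_continuous.
under eq_fun do rewrite big_cons.
by move=> x; apply: continuousM; [exact: cF|exact: IH].
Qed.

End ComplexContinuity.

Section ComplexMeasurable.
Context d (T : measurableType d) (R : realType).
Local Notation C := R[i].

Definition cmeasurable (f : T -> C) :=
  measurable_fun setT (fun x => complex.Re (f x)) /\
  measurable_fun setT (fun x => complex.Im (f x)).

Lemma cmeasurableM f g : cmeasurable f -> cmeasurable g -> cmeasurable (fun x => f x * g x).
Proof.
move=> [fr fi] [gr gi]; split.
- rewrite (_ : (fun x => _) = (fun x => complex.Re (f x) * complex.Re (g x) -
     complex.Im (f x) * complex.Im (g x))); last first.
    by apply/funext => x; case: (f x) (g x) => ? ? [].
  by apply: measurable_funB; exact: measurable_funM.
- rewrite (_ : (fun x => _) = (fun x => complex.Re (f x) * complex.Im (g x) +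
     complex.Im (f x) * complex.Re (g x))); last first.
    by apply/funext => x; case: (f x) (g x) => ? ? [].
  by apply: measurable_funD; exact: measurable_funM.
Qed.

Lemma cmeasurable_conj f : cmeasurable f -> cmeasurable (fun x => conjc (f x)).
Proof.
move=> [fr fi]; split.
- rewrite (_ : (fun x => _) = (fun x => complex.Re (f x)))//.
  by apply/funext => x; case: (f x).
- rewrite (_ : (fun x => _) = (fun x => - complex.Im (f x))).
    exact: measurableT_comp.
  by apply/funext => x; case: (f x).
Qed.

Lemma cmeasurable_prod (I : finType) (F : I -> T -> C) :
  (forall i, cmeasurable (F i)) -> cmeasurable (fun x => \prod_i F i x).
Proof.
move=> cF; elim: (index_enum I) => [|i s IH].
  by under eq_fun do rewrite big_nil; split; exact: measurable_cst.
by under eq_fun do rewrite big_cons; exact: cmeasurableM.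
Qed.

Lemma cintegrable_bounded (P : probability T R) f :
  cmeasurable f -> (forall x, `|f x| <= 1) -> cintegrable P setT f.
Proof.
move=> [fr fi] f1.
have int_g (g : T -> R) : measurable_fun setT g -> (forall x, `|g x| <= 1) ->
    P.-integrable setT (EFin \o g).
  move=> mg g1; apply: measurable_bounded_integrable => //.
    by apply: (le_lt_trans (probability_le1 P measurableT)); rewrite ltry.
  by exists 1; split => // r r1 x _; exact: le_trans (g1 x) (ltW r1).
by split; apply: int_g => // x; case: (norm_Re_Im_le1 (f1 x)).
Qed.

End ComplexMeasurable.

Lemma unitary_entry_le1 (C : numClosedFieldType) n (Q : 'M[C]_n) i j :
  Q \is unitarymx -> `|Q i j| <= 1.
Proof.
move=> /unitarymxP/matrixP/(_ i i); rewrite !mxE eqxx => e.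
have : `|Q i j| ^+ 2 <= 1.
  rewrite -[leRHS]/(true%:R) -e (bigD1 j)//= !mxE -normCK lerDl.
  by apply: sumr_ge0 => k _; rewrite !mxE -normCK exprn_ge0.
by rewrite expr_le1.
Qed.

(** * Invariance properties of the Haar moment *)

Section HaarMoment.
Context d (T : measurableType d) (R : realType) (P : probability T R).
Variables (N t : nat) (U : T -> 'M[R[i]]_N).
Hypothesis haarU : haar_rv P U.
Local Notation C := R[i].
Local Notation eps := (@is_inl 'I_t 'I_t).
Local Notation g := (@moment_index N t).
Local Notation tau := (tau g eps).
Local Notation lie := (lie g eps).
Local Notation cas := (casimir C g eps).

Definition haar_moment := mx_expect P (fun w => tau (U w)).
Local Notation H := haar_moment.

Lemma SU_unitarymx (V : 'M[C]_N) : SU N V -> V \is unitarymx.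
Proof.
move=> [VV _]; apply/unitarymxP; apply: mulmx1C.
by rewrite -cmx_adjE.
Qed.

Lemma haar_unitary w : U w \is unitarymx.
Proof. by case: haarU => SUw _; exact: SU_unitarymx. Qed.

Lemma tau_entry_le1 (V : 'M[C]_N) i j : V \is unitarymx -> `|tau V i j| <= 1.
Proof.
move=> Vu; apply: unitary_entry_le1; apply: tau_unitary => //.
exact: moment_index_bij.
Qed.

Lemma tau_entryE (V : 'M[C]_N) i j : tau V i j =
  \prod_s (if eps s then V (g i s) (g j s) else conjc (V (g i s) (g j s))).
Proof. by rewrite mxE; apply: eq_bigr => s _; case: (eps s); rewrite ?mxE. Qed.

Lemma tau_cintegrable i j : cintegrable P setT (fun w => tau (U w) i j).
Proof.
apply: cintegrable_bounded => [|w]; last by apply: tau_entry_le1; exact: haar_unitary.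
under eq_fun do rewrite tau_entryE.
have [_ [mU _]] := haarU.
apply: cmeasurable_prod => s; case: (eps s); first exact: mU.
by apply: cmeasurable_conj; exact: mU.
Qed.

Lemma tau_entry_continuous i j : continuous (fun V : 'M[C]_N => tau V i j : C).
Proof.
under eq_fun do rewrite tau_entryE.
apply: prod_continuous => s; case: (eps s); first exact: coord_continuous.
move=> V; apply: (@continuous_comp _ _ _ (fun V : 'M[C]_N => V (g i s) (g j s) : C) (@conjc R)).
  exact: coord_continuous.
exact: conjc_continuous.
Qed.

Lemma haar_momentE i j : H i j = cintegral P setT (fun w => tau (U w) i j).
Proof. by rewrite mxE. Qed.

Lemma mul_haar_moment p (A : 'M[C]_(p, _)) i j :
  (A *m H) i j = cintegral P setT (fun w => (A *m tau (U w)) i j).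
Proof.
have fZ k := cintegrableZ (@measurableT _ T) (A i k) (tau_cintegrable k j).
have [_ E] := cintegrable_sum (@measurableT _ T) (fun k => (fZ k).1).
rewrite mxE; transitivity (\sum_k cintegral P setT (fun w => A i k * tau (U w) k j)).
  by apply: eq_bigr => k _; rewrite (fZ k).2 haar_momentE.
by rewrite -E; apply: eq_cintegral => w _; rewrite mxE.
Qed.

Lemma haar_moment_mul p (A : 'M[C]_(_, p)) i j :
  (H *m A) i j = cintegral P setT (fun w => (tau (U w) *m A) i j).
Proof.
have fZ k := cintegrableZ (@measurableT _ T) (A k j) (tau_cintegrable i k).
have [_ E] := cintegrable_sum (@measurableT _ T) (fun k => (fZ k).1).
rewrite mxE; transitivity (\sum_k cintegral P setT (fun w => A k j * tau (U w) i k)).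
  by apply: eq_bigr => k _; rewrite (fZ k).2 haar_momentE mulrC.
rewrite -E; apply: eq_cintegral => w _; rewrite mxE; apply: eq_bigr => k _.
by rewrite mulrC.
Qed.

Lemma haar_moment_casimir : H *m cas = cas *m H.
Proof.
apply/matrixP => i j; rewrite haar_moment_mul mul_haar_moment; apply: eq_cintegral => w _.
by rewrite casimir_tauC//; [exact: moment_index_bij|exact: haar_unitary].
Qed.

Lemma haar_moment_fixed (x : 'cV[C]_(N ^ t * N ^ t)) :
  (forall i j, lie (delta_mx i j) *m x = 0) -> H *m x = x.
Proof.
move=> Lx; apply/matrixP => i j; rewrite haar_moment_mul.
rewrite (@eq_cintegral _ _ _ _ _ _ (fun=> x i j)); last first.
  move=> w _; rewrite tau_fixed//; [exact: moment_index_bij|exact: haar_unitary].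
have PT : (P : {measure set T -> \bar R}) setT = 1%E by exact: probability_setT.
rewrite /cintegral !Rintegral_cst// PT /= !mulr1.
by case: (x i j).
Qed.

(** Moving [tau V] inside the expectation turns U into V U. Invariance of the law is stated for real
    test functions, hence the separate treatment of real and imaginary parts. *)
Lemma haar_moment_invariant (V : 'M[C]_N) : SU N V -> tau V *m H = H.
Proof.
move=> SUV; apply/matrixP => i j; rewrite mul_haar_moment haar_momentE.
have [_ [_ inv]] := haarU.
have bij := moment_index_bij N t.
have clip (p : C -> R) : continuous p -> (forall z : C, `|z| <= 1 -> `|p z| <= 1) ->
    \int[P]_w p (tau (V *m U w) i j) = \int[P]_w p (tau (U w) i j).
  move=> cp p1.
  (* clipping turns the unbounded polynomial into a bounded test function *)
  pose f (A : 'M[C]_N) : R := Num.max (-1) (Num.min 1 (p (tau A i j))).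
  have fE A : A \is unitarymx -> f A = p (tau A i j).
    move=> Au; have := p1 _ (tau_entry_le1 i j Au); rewrite ler_norml => /andP[l r].
    by rewrite /f min_r// max_r.
  have cf : continuous f.
    have cq : continuous (fun A : 'M[C]_N => p (tau A i j)).
      move=> A; apply: (@continuous_comp _ _ _ (fun A : 'M[C]_N => tau A i j : C) p).
        exact: tau_entry_continuous.
      exact: cp.
    move=> A; apply: (@continuous_max R _ (fun=> -1)
      (fun A : 'M[C]_N => Num.min 1 (p (tau A i j)))); first exact: cst_continuous.
    apply: (@continuous_min R _ (fun=> 1) (fun A : 'M[C]_N => p (tau A i j))).
      exact: cst_continuous.
    exact: cq.
  have := inv V SUV f cf; under eq_Rintegral do rewrite fE ?mul_unitarymx ?haar_unitary ?SU_unitarymx//.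
  under [in X in _ = X]eq_Rintegral do rewrite fE ?haar_unitary//.
  apply; exists 1 => A; rewrite ler_norml /f le_max lexx /=.
  by rewrite ge_max ge_min lexx /= andbT; lra.
under eq_cintegral do rewrite tau_mul//.
rewrite /cintegral; congr (_ +i* _)%C; apply: clip.
- exact: Re_continuous.
- by move=> z /norm_Re_Im_le1[].
- exact: Im_continuous.
- by move=> z /norm_Re_Im_le1[].
Qed.

(** Invariance under finite rotations generated by Q takes the place of differentiation: it kills
    every row of [tau V *m H] of nonzero frequency, and [lie Q] vanishes on the others. *)
Lemma haar_moment_lie (V Q : 'M[C]_N) (e : 'I_N -> int) :
  V \is unitarymx -> Q = V^t* *m diag_mx (\row_k (e k)%:~R) *m V ->
  (forall k, e k = 1 \/ e k = -1) -> \tr Q = 0 -> lie Q *m H = 0.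
Proof.
move=> Vu QE e_sign trQ; have bij := moment_index_bij N t.
have bal := moment_balanced t.
have Tu := tau_unitary bij eps Vu; have TT := unitarymxP Tu.
have rot (x : R) : tau (rotation Q (x / 2)) *m H = H.
  apply: haar_moment_invariant; split; last exact: rotation_det Vu QE e_sign _ trQ.
  have rot_unitary := rotation_unitary Vu QE e_sign (x / 2).
  by rewrite cmx_adjE; exact: unitarymxK rot_unitary.
pose Y := tau V *m H.
have Y0 m j : half_weight e g eps m != 0 -> Y m j = 0.
  move=> hw; have := rot (pi / (half_weight e g eps m)%:~R).
  rewrite (tau_rotation Vu QE e_sign bij bal) -!mulmxA => /(congr1 (mulmx (tau V))).
  rewrite mulmxA TT mul1mx -/Y mul_diag_mx => /matrixP/(_ m j).
  rewrite mxE [X in X * _]mxE mulrCA divff ?intr_eq0// mulr1 /expi cospi sinpi => E.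
  have m1 : ((-1) +i* 0)%C = -1 :> C by apply/eqP; rewrite eq_complex /= oppr0 !eqxx.
  apply/eqP; have : Y m j *+ 2 = 0 by rewrite mulr2n -{1}E m1 mulN1r addNr.
  by move/eqP; rewrite mulrn_eq0.
rewrite QE lie_conj// lie_diag// -!mulmxA -/Y.
suff -> : diag_mx (\row_m \sum_k (\row_k0 (e k0)%:~R) 0 k * (weight g eps m k)%:~R) *m Y = 0.
  by rewrite mulmx0.
apply/matrixP => m j; rewrite mul_diag_mx mxE [X in X * _]mxE [RHS]mxE.
under eq_bigr do rewrite mxE -intrM.
rewrite -rmorph_sum /= (half_weightE e_sign _ bal).
have [->|/Y0 ->] := eqVneq (half_weight e g eps m) 0; last by rewrite mulr0.
by rewrite !mul0r.
Qed.

End HaarMoment.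

(** * Operator norm bound *)

Section Norms.
Variable R : realType.
Local Notation C := R[i].

Lemma sqnorm_vnorm n (x : 'cV[C]_n) : sqnorm x = (vnorm x ^+ 2)%:C%C.
Proof.
rewrite /vnorm sqr_sqrtr; last first.
  by apply: sumr_ge0 => i _; rewrite addr_ge0 ?sqr_ge0.
by rewrite rmorph_sum; apply: eq_bigr => i _; rewrite -add_Re2_Im2.
Qed.

Lemma opnorm_le m n (A : 'M[C]_(m, n)) (mu : R) : 0 <= mu ->
  (forall x, sqnorm (A *m x) <= mu%:C%C ^+ 2 * sqnorm x) -> opnorm A <= mu.
Proof.
move=> mu0 bound; apply: ge_sup.
  (* Bounding the supremum asks for a nonempty set; x = 0 provides an element. *)
  exists 0, 0; split; first rewrite /vnorm big1 ?sqrtr0//.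
    by move=> i _; rewrite mxE /= expr0n addr0.
  rewrite mulmx0 /vnorm big1 ?sqrtr0// => i _.
  by rewrite mxE /= expr0n addr0.
move=> _ [x [x1 ->]].
have v0 k (y : 'cV[C]_k) : 0 <= vnorm y by exact: sqrtr_ge0.
have := bound x; rewrite !sqnorm_vnorm -rmorphXn -rmorphM lecR -exprMn.
rewrite ler_pXn2r ?nnegrE ?mulr_ge0// => h; apply: (le_trans h).
by rewrite -[leRHS]mulr1 ler_wpM2l.
Qed.

(** The conjugate is again an involution, and exchanging i for - i amounts to exchanging x for - x.
    The second Kronecker factor of the integrand is thus the conjugate of the first, as in
    [kron_tau]. *)
Lemma expmx_conj_rotation N (P : 'M[C]_N) (x : R) : P *m P = 1%:M ->
  expmx ((- 'i * x%:C)%C *: cmx_conj P) = cmx_conj (rotation P x).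
Proof.
move=> PP; have -> : (- 'i * x%:C = 'i * (- x)%:C :> C)%C by simpc.
rewrite expmx_rotation; last by rewrite -map_mxM PP map_mx1.
apply/matrixP => i j; rewrite !mxE cosN sinN; case: (P i j) => a b.
case: (i == j); rewrite /=; simpc;
  apply/eqP; rewrite eq_complex /=; apply/andP; split; apply/eqP; ring.
Qed.

(** The right side subtracts N^2 K (K / t) / 2 + 2 K^2 from the common term, and K / t <= 2 makes
    this at most N^2 K + 2 K^2. *)
Lemma gap_large_weight (N t K s : R) : 2 <= N -> 1 <= t -> 0 < K -> K <= 2 * t ->
  N * (N * K) + 2 * K ^+ 2 <= N * s ->
  2 * (N ^+ 2 - 1) * K ^+ 2 - N * s <=
  (1 - (4 * t)^-1 * (N ^+ 2 / (N ^+ 2 - 1)) - (N ^+ 2 - 1)^-1) *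
    (2 * (N ^+ 2 - 1) * K ^+ 2).
Proof.
move=> N2 t1 K0 Kt h.
have N1 : N ^+ 2 - 1 != 0 by apply: lt0r_neq0; nra.
have t0 : t != 0 by apply: lt0r_neq0; lra.
have -> : (1 - (4 * t)^-1 * (N ^+ 2 / (N ^+ 2 - 1)) - (N ^+ 2 - 1)^-1) *
    (2 * (N ^+ 2 - 1) * K ^+ 2) =
  2 * (N ^+ 2 - 1) * K ^+ 2 - (N ^+ 2 * K * (K / t)) / 2 - 2 * K ^+ 2.
  by field; rewrite N1 t0.
have Kt2 : K / t <= 2 by rewrite ler_pdivrMr ?(lt_le_trans ltr01).
have : N ^+ 2 * K * (K / t) <= N ^+ 2 * K * 2.
  by rewrite ler_wpM2l// mulr_ge0 ?sqr_ge0 ?ltW.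
move: h; lra.
Qed.

(** The claim reduces to (N + 1) K (K / t) - K^2 <= s, where - K^2 stems from the - t in N - t + 1;
    it follows from K / t <= 2. *)
Lemma gap_small_weight (N t K s : R) : 2 <= N -> 1 <= t -> 0 < K -> K <= 2 * t ->
  2 * K + 2 * N * K - K ^+ 2 <= s ->
  2 * (N ^+ 2 - 1) * K ^+ 2 - N * s <=
  (1 - (2 * t)^-1 * (N * (N - t + 1) / (N ^+ 2 - 1))) *
    (2 * (N ^+ 2 - 1) * K ^+ 2).
Proof.
move=> N2 t1 K0 Kt h.
have N1 : N ^+ 2 - 1 != 0 by apply: lt0r_neq0; nra.
have t0 : t != 0 by apply: lt0r_neq0; lra.
have -> : (1 - (2 * t)^-1 * (N * (N - t + 1) / (N ^+ 2 - 1))) *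
    (2 * (N ^+ 2 - 1) * K ^+ 2) =
  2 * (N ^+ 2 - 1) * K ^+ 2 - N * ((N + 1) * K * (K / t) - K ^+ 2).
  by field; rewrite N1 t0.
rewrite lerD2l lerN2 ler_wpM2l//; first lra.
apply: le_trans h.
have Kt2 : K / t <= 2 by rewrite ler_pdivrMr ?(lt_le_trans ltr01).
have : (N + 1) * K * (K / t) <= (N + 1) * K * 2.
  by rewrite ler_wpM2l// mulr_ge0 ?ltW//; lra.
lra.
Qed.

(** Strict positivity is what [sqnorm_gap] asks of [mu]. Multiplied by N^2 - 1, the value is at
    least (3/4) N^2 - 2. *)
Lemma gap_large_pos (N t : R) : 2 <= N -> 1 <= t ->
  0 < 1 - (4 * t)^-1 * (N ^+ 2 / (N ^+ 2 - 1)) - (N ^+ 2 - 1)^-1.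
Proof.
move=> N2 t1; have N1 : 0 < N ^+ 2 - 1 by nra.
have t0 : t != 0 by apply: lt0r_neq0; lra.
rewrite -(pmulr_lgt0 _ N1).
have -> : (1 - (4 * t)^-1 * (N ^+ 2 / (N ^+ 2 - 1)) - (N ^+ 2 - 1)^-1) * (N ^+ 2 - 1) =
  N ^+ 2 - 2 - N ^+ 2 * t^-1 / 4 by field; rewrite t0 lt0r_neq0.
have : N ^+ 2 * t^-1 <= N ^+ 2 by rewrite ler_piMr ?sqr_ge0// invf_le1//; lra.
nra.
Qed.

(** Multiplied by N^2 - 1, the value is at least N^2 / 2 - 1 because 1 / t <= 1. *)
Lemma gap_small_pos (N t : R) : 2 <= N -> 1 <= t ->
  0 < 1 - (2 * t)^-1 * (N * (N - t + 1) / (N ^+ 2 - 1)).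
Proof.
move=> N2 t1; have N1 : 0 < N ^+ 2 - 1 by nra.
have t0 : t != 0 by apply: lt0r_neq0; lra.
rewrite -(pmulr_lgt0 _ N1).
have -> : (1 - (2 * t)^-1 * (N * (N - t + 1) / (N ^+ 2 - 1))) * (N ^+ 2 - 1) =
  N ^+ 2 - 1 - N * ((N + 1) * t^-1 - 1) / 2 by field; rewrite t0 lt0r_neq0.
have : (N + 1) * t^-1 <= N + 1 by rewrite ler_piMr ?invf_le1//; lra.
nra.
Qed.

End Norms.

Lemma opnorm_gap (R : realType) (n t : nat) (d : measure_display)
  (T : measurableType d) (P : probability T R) (U : T -> 'M[R[i]]_(2 ^ n)) (mu : R) :
  (1 <= n)%N -> haar_rv P U -> 0 < mu ->
  (forall h : 'I_(2 ^ n) -> int, \sum_k h k = 0 ->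
     \sum_k `|h k| <= (2 * t)%:R -> 0 < \sum_k `|h k| ->
     let K : R := (\sum_k `|h k|)%:~R in let N : R := (2 ^ n)%:R in
     2 * (N ^+ 2 - 1) * K ^+ 2 - N * (spread h)%:~R <= mu * (2 * (N ^+ 2 - 1) * K ^+ 2)) ->
  opnorm (pauli_rot_moment R n t -
    mx_expect P (fun w => kron (kronpow (U w) t) (kronpow (cmx_conj (U w)) t))) <= mu.
Proof.
move=> n1 haarU mu0 mu_bound.
have bij := moment_index_bij (2 ^ n) t; have bal := moment_balanced t.
(* One choice of spectral data per string, so that the projectors and the hypotheses of [sqnorm_gap]
   refer to the same diagonalisation. *)
have /choice[Ve HVe] : forall s : {ffun 'I_n -> 'I_4},
    exists Ve : 'M[R[i]]_(2 ^ n) * ('I_(2 ^ n) -> int),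
    [/\ Ve.1 \is unitarymx,
        pauli_string R s = Ve.1^t* *m diag_mx (\row_k (Ve.2 k)%:~R) *m Ve.1 &
        forall k, Ve.2 k = 1 \/ Ve.2 k = -1].
  move=> s.
  have [V [e He]] := involution_spectral (pauli_string_adj R s) (pauli_string_sq R s).
  by exists (V, e).
have N_gt1 : (1 < 2 ^ n)%N by rewrite -{1}(expn0 2) ltn_exp2l.
have n1E : (4 ^ n - 1)%N = ((2 ^ n) ^ 2 - 1)%N by rewrite -(expnM 2 n) mulnC expnM.
have -> : mx_expect P (fun w => kron (kronpow (U w) t) (kronpow (cmx_conj (U w)) t)) =
    haar_moment P t U.
  by rewrite /haar_moment; congr mx_expect; apply/funext => w; rewrite kron_tau.
(* Each angular average is the projector onto the kernel of [lie] of the string; the count of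
   nontrivial strings is rewritten through 4^n = N^2. *)
have -> : pauli_rot_moment R n t = ((2 ^ n) ^ 2 - 1)%:R^-1 *:
    \sum_(s | s != [ffun=> ord0])
      zero_weight_proj (@moment_index (2 ^ n) t) (@is_inl 'I_t 'I_t) (Ve s).1 (\row_k ((Ve s).2 k)%:~R).
  rewrite /pauli_rot_moment n1E; congr (_ *: _); apply: eq_bigr => s _.
  have [Vu PE e_sign] := HVe s; have PP := pauli_string_sq R s.
  rewrite (zero_weight_projE _ e_sign _ bal) -theta_avg_diag; congr theta_avg.
  apply/funext => th; rewrite expmx_rotation// expmx_conj_rotation// kron_tau.
  by rewrite (tau_rotation Vu PE e_sign bij bal).
apply: opnorm_le; first exact: ltW.
apply: (sqnorm_gap bij bal (P := fun s : {ffun 'I_n -> 'I_4} => pauli_string R s)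
  (V := fun s => (Ve s).1) (d := fun s => \row_k ((Ve s).2 k)%:~R)) => //.
- by move=> s; case: (HVe s).
- by move=> s; case: (HVe s).
- by move=> s k; rewrite mxE; case: (HVe s) => _ _ /(_ k) [] ->; [left|right].
- exact: pauli_string_complete.
- exact: pauli_string_id.
- exact: haar_moment_casimir.
- move=> s s0; have [Vu PE e_sign] := HVe s.
  by have := @haar_moment_lie _ _ _ _ _ t _ haarU _ _ _ Vu PE e_sign (pauli_string_trace _ s0).
- exact: haar_moment_fixed.
- by rewrite card_ffun !card_ord -expnM mulnC expnM.
- by rewrite ltcR.
move=> h h0; rewrite card_sum card_ord addnn -mul2n => hK K0.
have n1C : (((2 ^ n) ^ 2 - 1)%:R : R[i]) = (2 ^ n)%:R ^+ 2 - 1.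
  by rewrite natrB ?expn_gt0// natrX.
have := mu_bound h h0 hK K0; rewrite n1C /= -lecR.
move: (spread h) (\sum_k `|h k|) => s K.
by rewrite !(rmorphM, rmorphB, rmorphXn, rmorph1, rmorph_nat, rmorph_int).
Qed.

Theorem theorem5p1 (R : realType) (n t : nat) (d : measure_display)
  (T : measurableType d) (P : probability T R) (U : T -> 'M[R[i]]_(2 ^ n)) :
  (1 <= n)%N -> (1 <= t)%N -> haar_rv P U ->
  let N : R := (2 ^ n)%:R in
  let H := mx_expect P (fun w => kron (kronpow (U w) t) (kronpow (cmx_conj (U w)) t)) in
  let D := pauli_rot_moment R n t - H in
  opnorm D <= 1 - (4 * t%:R)^-1 * (N ^+ 2 / (N ^+ 2 - 1)) - (N ^+ 2 - 1)^-1 /\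
  ((2 * t <= 2 ^ n)%N ->
   opnorm D <= 1 - (2 * t%:R)^-1 * (N * (N - t%:R + 1) / (N ^+ 2 - 1))).
Proof.
move=> n1 t1 haarU N H D.
have N2 : 2 <= N by rewrite /N ler_nat -{1}(expn1 2) leq_exp2l.
have t1' : 1 <= t%:R :> R by rewrite ler1n.
have KR (h : 'I_(2 ^ n) -> int) : \sum_k `|h k| <= (2 * t)%:R ->
    (\sum_k `|h k|)%:~R <= 2 * t%:R :> R.
  by rewrite -(ler_int R) => /le_trans; apply; rewrite -natrM natz -pmulrn.
split=> [|_]; apply: (opnorm_gap n1 haarU).
- exact: gap_large_pos.
- move=> h h0 hK K0 /=; apply: gap_large_weight => //; [by rewrite ltr0z|exact: KR|].
  have := spread_ge_linear h0; rewrite -(ler_int R).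
  by rewrite !(intrM, intrD) !natz -!pmulrn.
- exact: gap_small_pos.
- move=> h h0 hK K0 /=; apply: gap_small_weight => //; [by rewrite ltr0z|exact: KR|].
  have := spread_ge_quadratic h0; rewrite -(ler_int R).
  by rewrite !(intrM, intrB, intrD) !natz -!pmulrn.
Qed.
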